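(* Let $n\geq 1$ and $m\geq 2$ be integers. Let $f(x)=\sum_{i=0}^n a_i x^i$ be a real polynomial of degree $n$, let $g(x,y)=\sum_{i+j\leq m} b_{ij}x^iy^j$ be a real bivariate polynomial of degree $m$, and consider the piecewise smooth planar system $$\dot x = y,\qquad \dot y=-x-\varepsilon\bigl(f(x)\,y+\operatorname{sgn}(x)\,g(x,y)\bigr).$$ For $|\varepsilon|\neq 0$ sufficiently small, the number $$H_{m,n}=\Bigl\lfloor \frac n2\Bigr\rfloor+\Bigl\lfloor \frac m2\Bigr\rfloor$$ is a lower bound for the maximum number (over all such $f$ of degree $n$ and $g$ of degree $m$) of limit cycles of this system bifurcating from the periodic orbits of the linear center $\dot x=y,\ \dot y=-x$. Moreover, there exist polynomials $f$ of degree $n$ and $g$ of degree $m$ for which exactly $H_{m,n}$ limit cycles of the system bifurcate from the periodic orbits of the linear center.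
   Context: The system is piecewise smooth with switching line $\Sigma=\{x=0\}$: it equals the smooth (polynomial) vector field $X=(y,\,-x-\varepsilon(f(x)y+g(x,y)))$ on $\{x>0\}$ and $Y=(y,\,-x-\varepsilon(f(x)y-g(x,y)))$ on $\{x<0\}$, where $\operatorname{sgn}(x)=1$ for $x>0$ and $-1$ for $x<0$. At a point $(0,y_0)$ with $y_0\neq 0$ both fields cross $\Sigma$ in the same direction, and the trajectory through it is obtained by concatenating the trajectories of $X$ and $Y$. A limit cycle is an isolated periodic orbit. The periodic orbits of the linear center are the circles $x^2+y^2=r^2$, $r>0$. For fixed $f,g$, the system has at least $k$ limit cycles bifurcating from the periodic orbits of the linear center if there is $\varepsilon_0>0$ such that for all $0<|\varepsilon|<\varepsilon_0$ it has $k$ pairwise distinct limit cycles $\Gamma_{1,\varepsilon},\dots,\Gamma_{k,\varepsilon}$, each $\Gamma_{\ell,\varepsilon}$ converging as $\varepsilon\to0$ to some circle $x^2+y^2=r_\ell^2$ with $r_\ell>0$. It has exactly $k$ such limit cycles if this holds for $k$ but not for $k+1$. The maximum number is the supremum of such $k$ over all admissible $f,g$. *)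

(* Defs.v *)
From HB Require Import structures.
From mathcomp Require Export all_boot all_order all_algebra.
From mathcomp Require Export all_classical all_reals all_analysis.
Export Order.TTheory GRing.Theory Num.Theory.
Export numFieldNormedType.Exports.

#[export] Set Implicit Arguments.
#[export] Unset Strict Implicit.
#[export] Unset Printing Implicit Defensive.

Local Open Scope classical_set_scope.
Local Open Scope ring_scope.

(* A bivariate polynomial is a polynomial in x whose coefficients are
   polynomials in y: g`_i`_j is the coefficient of x^i y^j, and
   g(x, y) = g.[x%:P].[y].  Degrees are exact. *)
Definition poly_degree (R : realType) (f : {poly R}) (n : nat) : Prop :=
  size f = n.+1.

Definition total_degree (R : realType) (g : {poly {poly R}}) (m : nat) : Prop :=
  (forall i j : nat, g`_i`_j != 0 -> (i + j <= m)%N) /\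
  (exists i j : nat, (i + j)%N = m /\ g`_i`_j != 0).

(* The field X is the case sigma = 1, the field Y the case sigma = -1. *)
Definition field_of (R : realType) (f : {poly R}) (g : {poly {poly R}})
    (eps sigma : R) (p : R * R) : R * R :=
  (p.2, - p.1 - eps * (f.[p.1] * p.2 + sigma * g.[p.1%:P].[p.2])).

Definition has_velocity (R : realType) (c : R -> R * R) (t : R) (v : R * R) :
    Prop :=
  is_derive t 1 (fun s => (c s).1) v.1 /\
  is_derive t 1 (fun s => (c s).2) v.2.

Definition integral_curve_on (R : realType) (V : R * R -> R * R) (I : set R)
    (c : R -> R * R) : Prop :=
  forall t, I t -> has_velocity c t (V (c t)).

(* At a crossing point (0, y0) with y0 != 0 both fields have first component
   y0, so the orbit comes from the side of sign - sg y0 and leaves on the side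
   of sign sg y0; c is then the concatenation at time t of an integral curve
   psi of the field of the former side and an integral curve phi of the field
   of the latter. *)
Definition crosses_at (R : realType) (f : {poly R}) (g : {poly {poly R}})
    (eps : R) (c : R -> R * R) (t : R) : Prop :=
  (c t).2 != 0 /\
  exists (d : R) (phi psi : R -> R * R),
    [/\ 0 < d,
        integral_curve_on (field_of f g eps (Num.sg (c t).2)) (ball t d) phi,
        integral_curve_on (field_of f g eps (- Num.sg (c t).2)) (ball t d) psi,
        (forall s, t <= s < t + d -> c s = phi s) &
        (forall s, t - d < s <= t -> c s = psi s)].

(* Trajectories meet the switching line x = 0 only at crossing points; in
   particular they avoid the origin, where no concatenation rule is defined. *)
Definition trajectory (R : realType) (f : {poly R}) (g : {poly {poly R}})
    (eps : R) (c : R -> R * R) : Prop :=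
  forall t,
    ((c t).1 != 0 ->
       has_velocity c t (field_of f g eps (Num.sg (c t).1) (c t))) /\
    ((c t).1 = 0 -> crosses_at f g eps c t).

Definition periodic_orbit (R : realType) (f : {poly R}) (g : {poly {poly R}})
    (eps : R) (G : set (R * R)) : Prop :=
  exists (c : R -> R * R) (T : R),
    [/\ 0 < T, trajectory f g eps c, (forall t, c (t + T) = c t),
        (exists t, c t <> c 0) & G = range c].

Definition limit_cycle (R : realType) (f : {poly R}) (g : {poly {poly R}})
    (eps : R) (G : set (R * R)) : Prop :=
  periodic_orbit f g eps G /\
  exists U : set (R * R), [/\ open U, G `<=` U &
    forall G' : set (R * R), periodic_orbit f g eps G' -> G' `<=` U -> G' = G].

Definition circle (R : realType) (r : R) : set (R * R) :=
  [set p | p.1 ^+ 2 + p.2 ^+ 2 = r ^+ 2].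

(* Hausdorff distance at most eta; ball on R * R is that of the sup norm, which
   defines the same notion of convergence as the Euclidean one. *)
Definition hausdorff_close (R : realType) (eta : R) (A B : set (R * R)) :
    Prop :=
  (forall a, A a -> exists2 b, B b & ball a eta b) /\
  (forall b, B b -> exists2 a, A a & ball b eta a).

Definition converges_to (R : realType) (G : R -> set (R * R))
    (B : set (R * R)) : Prop :=
  forall eta : R, 0 < eta -> \forall eps \near 0^', hausdorff_close eta (G eps) B.

Definition at_least_bifurcating (R : realType) (f : {poly R})
    (g : {poly {poly R}}) (k : nat) : Prop :=
  exists (eps0 : R) (G : 'I_k -> R -> set (R * R)) (r : 'I_k -> R),
    [/\ 0 < eps0,
        (forall eps : R, 0 < `|eps| < eps0 ->
           (forall l, limit_cycle f g eps (G l eps)) /\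
           (forall l l', l != l' -> G l eps <> G l' eps)),
        (forall l, 0 < r l) &
        (forall l, converges_to (G l) (circle (r l)))].

Definition exactly_bifurcating (R : realType) (f : {poly R})
    (g : {poly {poly R}}) (k : nat) : Prop :=
  at_least_bifurcating f g k /\ ~ at_least_bifurcating f g k.+1.

Definition max_bifurcating (R : realType) (m n : nat) : \bar R :=
  ereal_sup [set (k%:R : R)%:E | k in
    [set k : nat | exists (f : {poly R}) (g : {poly {poly R}}),
       [/\ poly_degree f n, total_degree g m & at_least_bifurcating f g k]]].

Definition Hmn (m n : nat) : nat := (n %/ 2 + m %/ 2)%N.

(* Main.v *)
(* In polar coordinates x = r sin phi, y = r cos phi the system becomes a scalar
   equation dr/dphi = eps * slope eps phi r.  At constant r the integral of slope 0
   over one turn is - r P(r) for a polynomial P.  We take for f a combination of even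
   powers of x and for g the product of y with a combination of odd powers of x, up to
   one more monomial in each that adjusts the degree and has zero average.  Then g
   vanishes on the switching line, so the field is continuous, and P is an arbitrary
   combination of the even powers up to n and of the odd powers below m, that is of
   H + 1 monomials.  By dimension some nonzero such P vanishes at 1, ..., H, and by
   Descartes' bound these are its only positive roots and they are simple.

   Near a circle whose radius is not a root of P, the radius drifts at every turn and
   there is no periodic orbit.  Near a simple root a periodic orbit exists by the
   intermediate value theorem, and it is unique: the logarithm of the squared distance
   of two periodic solutions would change at every turn by about a nonzero multiple of
   eps, given by the derivative of r P(r).  So exactly H families bifurcate. *)

(* The angle is measured from the y-axis so that the linear center is phi' = 1 with r constant.

   Since the field is continuous, every trajectory in the sense of the definition is an integral
   curve of one field, and polar coordinates can be taken along it. Conversely [crosses_at] asks for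
   integral curves of X and of Y on both sides of the switching line, so each of these fields needs
   a polar form of its own and a local solution through the crossing point.

   No return map is differentiated: at a fixed angle the radial equation is rational in r, and
   bounds on its slope, uniform in the angle, are combined with differential inequalities along
   solutions.

   Two points decide the exact count. A periodic orbit may close up only after several turns, so
   nonexistence and uniqueness are proved for periods [tau *+ k]. And the families in
   [at_least_bifurcating] depend on eps in an arbitrary way, so uniqueness must hold among all
   periodic orbits in a fixed annulus, for each small eps separately. *)
Require Import Defs.
From mathcomp Require Import ring lra zify.

Local Open Scope classical_set_scope.
Local Open Scope ring_scope.

(** * Antiderivatives and Gronwall's inequality *)

Section Calculus.
Variable R : realType.
Implicit Types (f g u w : R -> R) (a b s t x y : R).

Lemma is_derive_continuous_at f t l : is_derive t 1 f l -> {for t, continuous f}.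
Proof. by case=> df _; exact/differentiable_continuous/derivable1_diffP. Qed.

Lemma is_derive_continuous f w : (forall t, is_derive t 1 f (w t)) -> continuous f.
Proof. by move=> df t; exact: is_derive_continuous_at (df t). Qed.

Lemma derive_ge0_le f w a b : a <= b -> (forall t, is_derive t 1 f (w t)) ->
  (forall t, a <= t <= b -> 0 <= w t) -> f a <= f b.
Proof.
move=> ab df w0; rewrite -subr_ge0.
have [|c cab ->] := @MVT_segment R f w a b ab.
  by apply/continuous_subspaceT; exact: is_derive_continuous df.
by apply: mulr_ge0; [exact: w0|rewrite subr_ge0].
Qed.

Lemma derive_dominated u g w v a b : (forall t, is_derive t 1 u (w t)) ->
  (forall t, is_derive t 1 g (v t)) -> a <= b ->
  (forall t, a <= t <= b -> `|w t| <= v t) -> `|u b - u a| <= g b - g a.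
Proof.
move=> du dg ab wv.
have H1 : (g - u) a <= (g - u) b.
  apply: (@derive_ge0_le _ (fun t => v t - w t)) => // t /wv.
  by rewrite ler_norml subr_ge0 => /andP[].
have H2 : (g + u) a <= (g + u) b.
  apply: (@derive_ge0_le _ (fun t => v t + w t)) => // t /wv.
  by rewrite ler_norml => /andP[+ _]; rewrite addrC -lerBlDr sub0r.
rewrite !fctE in H1 H2.
by rewrite ler_norml; apply/andP; split; lra.
Qed.

(** The integral from a fixed a is an antiderivative only to the right of a. The base point [m x]
    therefore moves with x, and subtracting the integral up to t0 makes the value independent of the
    base point ([glue]). *)
Lemma antiderivative f t0 : continuous f ->
  exists2 F, F t0 = 0 & forall t, is_derive t 1 F (f t).
Proof.
move=> cf.
pose I a x := (\int[lebesgue_measure]_(t in `[a, x]) f t)%R.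
have dI a x : a < x -> is_derive x 1 (I a) (f x).
  move=> ax; have [//|||dFx F'x] := @continuous_FTC1_closed R f a x (x + 1) _ _ ax.
  - by rewrite ltrDl.
  - apply: continuous_compact_integrable; first exact: segment_compact.
    exact: continuous_subspaceT.
  - exact: cf.
  - by rewrite -F'x derive1E; exact: DeriveDef.
have Icst a a' x y : a < x -> a' < x -> x <= y -> I a y - I a' y = I a x - I a' x.
  move=> ax a'x xy.
  have [||c _] := @MVT_segment R (I a - I a') (cst 0) x y xy.
  - move=> z; rewrite in_itv/= => /andP[xz _]; rewrite /cst -(subrr (f z)).
    by apply: is_deriveB; apply: dI; exact: lt_trans xz.
  - apply: continuous_in_subspaceT => z; rewrite inE/= in_itv/= => /andP[xz _].
    have := is_deriveB (dI a z (lt_le_trans ax xz)) (dI a' z (lt_le_trans a'x xz)).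
    exact: is_derive_continuous_at.
  - by rewrite mul0r => /eqP; rewrite subr_eq0 => /eqP.
pose m x := Num.min x t0 - 1.
have m_lt x : m x < x by rewrite /m; case: (leP x t0) => ?; lra.
have m_lt0 x : m x < t0 by rewrite /m; case: (leP x t0) => ?; lra.
have glue a x : a < x -> a < t0 -> I (m x) x - I (m x) t0 = I a x - I a t0.
  move=> ax a0; have [x0|/ltW x0] := leP x t0.
  - by have := Icst _ _ _ _ (m_lt x) ax x0; lra.
  - by have := Icst _ _ _ _ (m_lt0 x) a0 x0; lra.
exists (fun x => I (m x) x - I (m x) t0) => [|t]; first exact: subrr.
apply: (@near_eq_is_derive _ _ _ (fun x => I (m t) x - I (m t) t0)).
  near=> x; rewrite (glue (m t)) //.
  by near: x; apply: lt_nbhsr; exact: m_lt.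
rewrite -[f t]subr0; apply: is_deriveB; exact: dI.
Unshelve. all: by end_near. Qed.

(** The product of u with an exponential is monotone. Forward in time this uses the upper bound on
    the derivative, backward in time the lower one. *)
Lemma gronwall u w L a b : (forall t, is_derive t 1 u (w t)) ->
  (forall t, Num.min a b <= t <= Num.max a b -> `|w t| <= L * u t) ->
  u b <= u a * expR (L * `|b - a|).
Proof.
move=> du wu.
have dE (k : R) t : is_derive t 1 (fun s => u s * expR (k * s))
    ((w t + k * u t) * expR (k * t)).
  have dk : is_derive t 1 (fun s => k * s) k.
    by apply: is_derive_eq; rewrite /GRing.scale /=; ring.
  have := is_derive1_comp (is_derive_expR (k * t)) dk.
  move=> /(is_deriveM (du t)) H; apply: is_derive_eq H _.
  by rewrite /GRing.scale /=; ring.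
have [ab|/ltW ba] := leP a b.
- have : u b * expR (- L * b) <= u a * expR (- L * a).
    rewrite -lerN2.
    apply: (@derive_ge0_le (fun t => - (u t * expR (- L * t))) (fun t => - ((w t + - L * u t) * expR (- L * t)))) => //.
    move=> t tab; rewrite oppr_ge0 mulr_le0_ge0 ?expR_ge0//.
    have := wu t; rewrite (min_idPl ab) (max_idPr ab) => /(_ tab).
    by rewrite ler_norml => /andP[_]; lra.
  rewrite ger0_norm ?subr_ge0// => H.
  rewrite -(ler_pM2r (expR_gt0 (- L * b))); apply: (le_trans H).
  by rewrite -mulrA -expRD; have -> : L * (b - a) + - L * b = - L * a by ring.
- have : u b * expR (L * b) <= u a * expR (L * a).
    apply: (@derive_ge0_le (fun t => u t * expR (L * t)) (fun t => (w t + L * u t) * expR (L * t))) => //.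
    move=> t tab; rewrite mulr_ge0 ?expR_ge0//.
    have := wu t; rewrite (min_idPr ba) (max_idPl ba) => /(_ tab).
    by rewrite ler_norml => /andP[]; lra.
  rewrite ler0_norm ?subr_le0// => H.
  rewrite -(ler_pM2r (expR_gt0 (L * b))); apply: (le_trans H).
  by rewrite -mulrA -expRD; have -> : L * - (b - a) + L * b = L * a by ring.
Qed.

End Calculus.

Section Calculus2.
Variable R : realType.
Implicit Types (f g u w : R -> R) (a b s t x y : R).

Lemma derive_ge_inverse g w (c : R) : 0 < c -> (forall t, is_derive t 1 g (w t)) ->
  (forall t, c <= w t) ->
  exists k, [/\ cancel g k, cancel k g & forall y, is_derive y 1 k (w (k y))^-1].
Proof.
move=> c0 dg cw.
have growth a b : a <= b -> c * (b - a) <= g b - g a.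
  move=> ab.
  have : (g - (fun t => c * t)) a <= (g - (fun t => c * t)) b.
    apply: (@derive_ge0_le _ _ (fun t => w t - c)) => // t; last by rewrite subr_ge0.
    by apply: is_deriveB; apply: is_derive_eq; rewrite /GRing.scale /=; ring.
  by rewrite !fctE; lra.
have ginj : injective g.
  move=> a b gab; have [ab|/ltW ba] := leP a b.
  - have := growth _ _ ab; rewrite gab subrr pmulr_rle0// => ?; lra.
  - have := growth _ _ ba; rewrite gab subrr pmulr_rle0// => ?; lra.
have cg : continuous g := is_derive_continuous dg.
have gsurj y : exists x, g x = y.
  (* Growing at rate at least c, [g] passes the value y within distance M of 0. *)
  pose M := `|y - g 0| / c.
  have M0 : 0 <= M by rewrite divr_ge0// ltW.
  have cM : c * M = `|y - g 0| by rewrite mulrC divfK// gt_eqF.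
  have H1 := growth 0 M M0.
  have H2 := growth (- M) 0; rewrite oppr_le0 in H2; have {}H2 := H2 M0.
  have := ler_norm (y - g 0); have := ler_norm (- (y - g 0)); rewrite normrN => n1 n2.
  have ab : - M <= M by lra.
  have lo : g (- M) <= y by lra.
  have hi : y <= g M by lra.
  have [|x _ <-] := IVT ab (continuous_subspaceT cg) (v := y); last by exists x.
  by rewrite (min_idPl _) ?(max_idPr _) ?lo ?hi ?(le_trans lo hi).
have [k kK] := choice gsurj.
have gK : cancel g k by move=> x; apply: ginj; rewrite kK.
exists k; split => // y; rewrite -{1}(kK y).
apply: is_derive_inverse => //.
- by near=> z; exact: gK.
- by near=> z; exact: cg.
- by rewrite gt_eqF// (lt_le_trans c0).
Unshelve. all: by end_near. Qed.

(** In Caratheodory's form a derivative is the value at t of a continuous slope function, and two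
    such functions with the same value at t glue to a continuous one. *)
Lemma is_derive_glue f g1 g2 t l d : 0 < d ->
  is_derive t 1 g1 l -> is_derive t 1 g2 l ->
  (forall s, t <= s < t + d -> f s = g1 s) ->
  (forall s, t - d < s <= t -> f s = g2 s) -> is_derive t 1 f l.
Proof.
move=> d0 /is_derive1_caratheodory [h1 [E1 c1 l1]].
move=> /is_derive1_caratheodory [h2 [E2 c2 l2]] fg1 fg2.
have t1 : f t = g1 t by apply: fg1; lra.
have t2 : f t = g2 t by apply: fg2; lra.
apply: (@near_eq_is_derive _ _ _ (fun z => if t <= z then g1 z else g2 z)).
  near=> z; case: leP => tz; apply/esym; [apply: fg1|apply: fg2].
    by rewrite tz; near: z; apply: lt_nbhsl; lra.
  by rewrite (ltW tz) andbT; near: z; apply: lt_nbhsr; lra.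
apply/is_derive1_caratheodory; exists (fun z => if t <= z then h1 z else h2 z).
split; last by rewrite lexx.
- by move=> z; rewrite lexx -t1; case: leP => _; [rewrite t1 -E1|rewrite t2 -E2].
- apply/cvgrPdist_lt => e e0; rewrite lexx.
  have /cvgrPdist_lt/(_ _ e0) N1 := c1.
  have /cvgrPdist_lt/(_ _ e0) N2 := c2.
  near=> z; case: (leP t z) => _; first by near: z.
  by rewrite l1 -l2; near: z.
Unshelve. all: by end_near. Qed.

End Calculus2.

(** * Scalar differential equations *)

Section Picard.
Variable R : realType.

Lemma is_derive_expR_comp (u : R -> R) (t l : R) : is_derive t 1 u l ->
  is_derive t 1 (fun s => expR (u s)) (l * expR (u t)).
Proof.
by rewrite mulrC; exact: (@is_derive1_comp R (@expR R) u t _ l (is_derive_expR _)).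
Qed.

Lemma le_geometric_error (x y K : R) :
  (forall n : nat, x <= y + K / 2 ^+ n) -> x <= y.
Proof.
move=> H; rewrite leNgt; apply/negP => yx.
have e0 : 0 < x - y by rewrite subr_gt0.
have [K0|K0] := leP K 0.
  have := H 0%N; rewrite expr0 divr1; lra.
have [n Hn] : exists n : nat, K / (x - y) < 2 ^+ n.
  exists (Num.bound (K / (x - y))).
  apply: lt_trans (archi_boundP _) _; first by rewrite divr_ge0// ltW.
  by rewrite -natrX ltr_nat ltn_expl.
have := H n; rewrite leNgt => /negP; apply.
have p2 : 0 < 2 ^+ n :> R by rewrite exprn_gt0.
rewrite -ltrBrDl ltr_pdivrMr//.
by move: Hn; rewrite ltr_pdivrMr// mulrC.
Qed.

(** The intervals of radius 2K/2^n about [u n] are nested, because the radius drops by exactly K/2^n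
    at each step. The supremum of their left ends lies in all of them. *)
Lemma geometric_cauchy_limit (u : nat -> R) (K : R) :
  (forall n, `|u n.+1 - u n| <= K / 2 ^+ n) ->
  exists l, forall n, `|l - u n| <= 2 * K / 2 ^+ n.
Proof.
move=> du; pose lo n := u n - 2 * K / 2 ^+ n; pose hi n := u n + 2 * K / 2 ^+ n.
have K0 : 0 <= K by have := le_trans (normr_ge0 _) (du 0%N); rewrite expr0 divr1.
have half n : 2 * K / 2 ^+ n.+1 = K / 2 ^+ n :> R.
  by rewrite exprS invfM; field; rewrite expf_neq0//=; lra.
have dbl n : 2 * K / 2 ^+ n = K / 2 ^+ n + K / 2 ^+ n :> R by rewrite -mulrA; ring.
have lo_hom : {homo lo : n m / (n <= m)%N >-> n <= m}.
  apply: homo_leq => [|y x z|n]; [exact: lexx|exact: le_trans|].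
  rewrite /lo half dbl; have := du n; rewrite ler_norml => /andP[]; lra.
have hi_hom : {homo hi : n m / (n <= m)%N >-> m <= n}.
  apply: homo_leq => [|y x z|n]; first exact: lexx.
    by move=> + h; apply: le_trans.
  rewrite /hi half dbl; have := du n; rewrite ler_norml => /andP[]; lra.
have lohi n m : lo n <= hi m.
  apply: (le_trans (lo_hom _ _ (leq_maxl n m))).
  apply: (le_trans _ (hi_hom _ _ (leq_maxr n m))).
  rewrite /lo /hi; have : 0 <= 2 * K / 2 ^+ (maxn n m) by rewrite !mulr_ge0// invr_ge0 exprn_ge0.
  lra.
exists (sup (range lo)) => n; rewrite ler_norml.
have H1 : lo n <= sup (range lo).
  apply: ub_le_sup; last by exists n.
  by exists (hi 0%N) => _ [m _ <-].
have H2 : sup (range lo) <= hi n.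
  apply: ge_sup; first by exists (lo 0%N), 0%N.
  by move=> _ [m _ <-].
by rewrite /lo /hi in H1 H2; apply/andP; split; lra.
Qed.

Variables (F : R -> R -> R) (L B t0 r0 : R).
Hypothesis L0 : 0 < L.
Hypothesis contF : forall c : R -> R, continuous c -> continuous (fun t => F t (c t)).
Hypothesis lipF : forall t x y, `|F t x - F t y| <= L * `|x - y|.
Hypothesis boundF : forall t x, `|F t x| <= B.
Implicit Types (u w : R -> R) (k t : R).

(* In the norm weighted by 1 / E the Picard map contracts by 1/2 on the whole line. *)
Let E t := expR (2 * L * (t - t0)) + expR (- (2 * L * (t - t0))).

(** The antiderivative of [k * E] vanishing at t0 is a difference of exponentials, bounded by
    [k / (2 * L) * E]. Combined with a Lipschitz constant L this yields the contraction factor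
    1/2. *)
Let dominated_by_E u w k : u t0 = 0 -> 0 <= k ->
  (forall t, is_derive t 1 u (w t)) -> (forall t, `|w t| <= k * E t) ->
  forall t, `|u t| <= k / (2 * L) * E t.
Proof.
move=> u0 k0 du wE t; have L2 : 0 < 2 * L by rewrite mulr_gt0.
have ne := lt0r_neq0 L0.
pose G s := k / (2 * L) * (expR (2 * L * (s - t0)) - expR (- (2 * L * (s - t0)))).
have G0 : G t0 = 0 by rewrite /G subrr mulr0 oppr0 subrr mulr0.
have dlin (s : R) : is_derive s 1 (fun s => 2 * L * (s - t0)) (2 * L).
  by apply: is_derive_eq; rewrite /GRing.scale /=; ring.
have dlinN (s : R) : is_derive s 1 (fun s => - (2 * L * (s - t0))) (- (2 * L)).
  exact: (is_deriveN (dlin s)).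
have dG (s : R) : is_derive s 1 G (k * E s).
  have d1 := is_derive_expR_comp (dlin s).
  have d2 := is_derive_expR_comp (dlinN s).
  have := is_deriveZ (k / (2 * L)) (is_deriveB d1 d2).
  move=> H; apply: is_derive_eq H _; rewrite /GRing.scale /= /E; field.
  by rewrite ne.
have kL : 0 <= k / (2 * L) by rewrite divr_ge0// ltW.
have eE (x : R) : 0 <= expR x by exact: expR_ge0.
have GE : `|G t| <= k / (2 * L) * E t.
  rewrite /G normrM (ger0_norm kL) ler_wpM2l// ler_norml /E.
  by have := eE (2 * L * (t - t0)); have := eE (- (2 * L * (t - t0))); lra.
apply: le_trans GE.
have [tt0|/ltW tt0] := leP t0 t.
- have := derive_dominated du dG tt0 (fun s _ => wE s).
  by rewrite u0 G0 !subr0 => /le_trans; apply; exact: ler_norm.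
- have := derive_dominated du dG tt0 (fun s _ => wE s).
  by rewrite u0 G0 !sub0r normrN => /le_trans; apply; rewrite -normrN ler_norm.
Qed.

Let E_ge1 t : 1 <= E t.
Proof.
rewrite /E; have := expR_ge0 (2 * L * (t - t0)); have := expR_ge0 (- (2 * L * (t - t0))).
have := expR_ge1Dx (2 * L * (t - t0)); have := expR_ge1Dx (- (2 * L * (t - t0))).
have [] := leP 0 (2 * L * (t - t0)); lra.
Qed.

Let E_ge0 t : 0 <= E t := le_trans ler01 (E_ge1 t).

(** The hypotheses on [F] are global, so the solution exists on the whole line without any
    continuation argument. Radial equations meet them after truncation of the radius. *)
Lemma picard : exists2 c, c t0 = r0 & forall t, is_derive t 1 c (F t (c t)).
Proof.
have B0 : 0 <= B := le_trans (normr_ge0 _) (boundF t0 r0).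
(* [T] is the Picard map; its value on a discontinuous function is a dummy. *)
have /choice[T TP] : forall c : R -> R, exists c', continuous c ->
    c' t0 = r0 /\ forall t, is_derive t 1 c' (F t (c t)).
  move=> c; have [cc|nc] := pselect (continuous c); last by exists c => /nc.
  have [G G0 dG] := antiderivative t0 (contF cc).
  exists (fun t => r0 + G t) => _; rewrite G0 addr0; split => // t.
  by rewrite -[F t (c t)]add0r; exact: is_deriveD.
pose u n := iter n T (cst r0).
have cu n : continuous (u n).
  elim: n => [|n /TP[_ d]]; first exact: cst_continuous.
  exact: is_derive_continuous d.
have u0 n : u n t0 = r0 by case: n => // n; have [] := TP _ (cu n).
have du n (t : R) : is_derive t 1 (u n.+1) (F t (u n t)) by have [] := TP _ (cu n).
pose A := B / (2 * L).
have L_ge0 : 0 <= L := ltW L0.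
have A0 : 0 <= A by rewrite divr_ge0// mulr_ge0// ltW.
have step n t : `|u n.+1 t - u n t| <= A * E t / 2 ^+ n.
  elim: n t => [|n IH] t.
    rewrite expr0 divr1.
    have := @dominated_by_E (fun t => u 1%N t - u 0%N t) (fun t => F t (u 0%N t)) B.
    apply => //; first by rewrite !u0 subrr.
    - by move=> s; apply: is_derive_eq; rewrite subr0.
    - by move=> s; rewrite (le_trans (boundF _ _))// ler_peMr.
  have -> : A * E t / 2 ^+ n.+1 = (L * A / 2 ^+ n) / (2 * L) * E t.
    rewrite exprS; field; rewrite (lt0r_neq0 L0) expf_neq0//=; lra.
  have := @dominated_by_E (fun t => u n.+2 t - u n.+1 t)
    (fun t => F t (u n.+1 t) - F t (u n t)).
  apply; first by rewrite !u0 subrr.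
  - by apply: divr_ge0; [exact: mulr_ge0|exact: exprn_ge0].
  - move=> s; apply: (le_trans (lipF _ _ _)).
    by rewrite -!mulrA ler_pM2l// (le_trans (IH s))// -!mulrA [_ / _]mulrC.
have /choice[c cP] : forall t, exists l, forall n, `|l - u n t| <= 2 * (A * E t) / 2 ^+ n.
  by move=> t; exact: geometric_cauchy_limit.
have ct0 : c t0 = r0.
  apply/eqP; rewrite -subr_eq0 -normr_eq0 eq_le normr_ge0 andbT.
  apply: (@le_geometric_error _ _ (2 * (A * E t0))) => n.
  by rewrite add0r -(u0 n).
(* All iterates share the Lipschitz constant B, so their pointwise limit is continuous and [T]
   applies to it. *)
have lip_u n s t : s <= t -> `|u n t - u n s| <= B * (t - s).
  move=> st; case: n => [|n].
    by rewrite subrr normr0 mulr_ge0// subr_ge0.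
  have dB (x : R) : is_derive x 1 (fun x => B * x) B.
    by apply: is_derive_eq; rewrite /GRing.scale /=; ring.
  have := derive_dominated (du n) dB st (fun x _ => boundF _ _).
  by rewrite -mulrBr.
have lip_c s t : s <= t -> `|c t - c s| <= B * (t - s).
  move=> st; apply: (@le_geometric_error _ _ (2 * (A * E t) + 2 * (A * E s))) => n.
  have -> : c t - c s = (u n t - u n s) + ((c t - u n t) - (c s - u n s)) by ring.
  rewrite (le_trans (ler_normD _ _))// lerD ?lip_u//.
  by rewrite (le_trans (ler_normB _ _))// mulrDl lerD.
have cc : continuous c.
  move=> t; apply/cvgrPdist_lt => e e0; near=> s.
  have : `|t - s| < e / (B + 1).
    near: s; apply: cvgr_dist_lt; first exact: cvg_id.
    by rewrite divr_gt0//; lra.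
  rewrite ltr_pdivlMr; last lra.
  move=> He; suff : `|c t - c s| <= B * `|t - s| by have := normr_ge0 (t - s); lra.
  have [st|/ltW ts] := leP s t; first by rewrite (ger0_norm (_ : 0 <= t - s)) ?lip_c ?subr_ge0.
  by rewrite distrC (distrC t) (ger0_norm (_ : 0 <= s - t)) ?lip_c ?subr_ge0.
have [D0 dD] := TP _ cc.
suff cT : c = T c by exists c => // t; move: (dD t); rewrite -cT.
apply/funext => t; apply/eqP; rewrite -subr_eq0 -normr_eq0 eq_le normr_ge0 andbT.
apply: (@le_geometric_error _ _ (2 * (A * E t) + 2 * (A * E t))) => n.
have -> : c t - T c t = (c t - u n.+1 t) - (T c t - u n.+1 t) by ring.
rewrite add0r (le_trans (ler_normB _ _))// mulrDl lerD//.
  rewrite (le_trans (cP t n.+1))// ler_wpM2l//.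
    by apply: mulr_ge0 => //; exact: mulr_ge0.
  by rewrite lef_pV2 ?posrE ?exprn_gt0// ler_weXn2l//; lra.
have -> : 2 * (A * E t) / 2 ^+ n = (L * (4 * A) / 2 ^+ n) / (2 * L) * E t.
  field; rewrite (lt0r_neq0 L0) expf_neq0//=; lra.
have := @dominated_by_E (fun t => T c t - u n.+1 t) (fun t => F t (c t) - F t (u n t)).
apply; first by rewrite D0 u0 subrr.
- by apply: divr_ge0; [apply: mulr_ge0 => //; exact: mulr_ge0|exact: exprn_ge0].
- move=> s; apply: (le_trans (lipF _ _ _)).
  have -> : L * (4 * A) / 2 ^+ n * E s = L * (2 * (2 * (A * E s) / 2 ^+ n)) by ring.
  rewrite ler_pM2l// (le_trans (cP s n))// ler_peMl//; last lra.
  by apply: divr_ge0; [apply: mulr_ge0 => //; exact: mulr_ge0|exact: exprn_ge0].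
Unshelve. all: by end_near. Qed.

End Picard.

(** * The radial equation in polar coordinates *)

Section Tame.
Variables (R : realType) (rho : R).
Implicit Types (g dg : R -> R -> R) (C phi x y z : R).

(* Uniform C^{1,1} bounds in the radius on [0, rho], with dg the radial
   derivative of g. *)
Definition tame_bound C g dg phi x y z :=
  [/\ `|g phi x| <= C, `|dg phi x| <= C, `|g phi x - g phi y| <= C * `|x - y| &
    `|g phi x - g phi y - dg phi z * (x - y)| <=
      C * ((`|x - z| + `|y - z|) * `|x - y|)].

Definition tame g dg := exists2 C, 0 <= C & forall phi x y z,
  0 <= x <= rho -> 0 <= y <= rho -> 0 <= z <= rho -> tame_bound C g dg phi x y z.

Lemma tame_angle (a : R -> R) (M : R) : (forall phi, `|a phi| <= M) ->
  tame (fun phi _ => a phi) (fun _ _ => 0).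
Proof.
move=> aM; have M0 : 0 <= M := le_trans (normr_ge0 _) (aM 0).
exists M => // phi x y z _ _ _; rewrite /tame_bound mul0r !subrr !normr0.
by split => //; rewrite !mulr_ge0// addr_ge0.
Qed.

Lemma tame_radius : tame (fun _ r => r) (fun _ _ => 1).
Proof.
exists (1 + `|rho|) => [|phi x y z x0 y0 z0]; first by rewrite addr_ge0.
have := ler_norm rho; rewrite /tame_bound => ?.
split.
- rewrite ger0_norm; lra.
- by rewrite normr1 lerDl.
- by rewrite ler_peMl// lerDl.
- by rewrite mul1r subrr normr0 !mulr_ge0 ?addr_ge0.
Qed.

Lemma tameD g1 dg1 g2 dg2 : tame g1 dg1 -> tame g2 dg2 ->
  tame (fun phi r => g1 phi r + g2 phi r) (fun phi r => dg1 phi r + dg2 phi r).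
Proof.
move=> [C1 C10 H1] [C2 C20 H2]; exists (C1 + C2) => [|phi x y z x0 y0 z0].
  exact: addr_ge0.
have [a1 b1 c1 d1] := H1 phi x y z x0 y0 z0.
have [a2 b2 c2 d2] := H2 phi x y z x0 y0 z0.
rewrite /tame_bound ![(C1 + C2) * _]mulrDl; split; try by rewrite (le_trans (ler_normD _ _))// lerD.
- have -> : g1 phi x + g2 phi x - (g1 phi y + g2 phi y) =
    (g1 phi x - g1 phi y) + (g2 phi x - g2 phi y) by ring.
  by rewrite (le_trans (ler_normD _ _))// lerD.
- have -> : g1 phi x + g2 phi x - (g1 phi y + g2 phi y) -
      (dg1 phi z + dg2 phi z) * (x - y) =
    (g1 phi x - g1 phi y - dg1 phi z * (x - y)) +
    (g2 phi x - g2 phi y - dg2 phi z * (x - y)) by ring.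
  by rewrite (le_trans (ler_normD _ _))// lerD.
Qed.

Lemma tameM g1 dg1 g2 dg2 : tame g1 dg1 -> tame g2 dg2 ->
  tame (fun phi r => g1 phi r * g2 phi r)
    (fun phi r => dg1 phi r * g2 phi r + g1 phi r * dg2 phi r).
Proof.
move=> [C1 C10 H1] [C2 C20 H2].
exists (4 * (C1 * C2)) => [|phi x y z x0 y0 z0]; first by rewrite !mulr_ge0.
have [a1 b1 c1 d1] := H1 phi x y z x0 y0 z0.
have [a2 b2 c2 d2] := H2 phi x y z x0 y0 z0.
have [az1 _ _ _] := H1 phi z y z z0 y0 z0.
have [az2 _ _ _] := H2 phi z y z z0 y0 z0.
have [ay2 _ cyz2 _] := H2 phi y z z y0 z0 z0.
have [_ _ cxz1 _] := H1 phi x z z x0 z0 z0.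
have C0 : 0 <= C1 * C2 by exact: mulr_ge0.
have M (p q a b : R) : `|p| <= a -> `|q| <= b -> `|p * q| <= a * b.
  by move=> pa qb; rewrite normrM ler_pM.
rewrite /tame_bound; split.
- by rewrite (le_trans (M _ _ _ _ a1 a2))// ler_peMl//; clear; lra.
- rewrite (le_trans (ler_normD _ _))//.
  by have t := M _ _ _ _ b1 a2; have t' := M _ _ _ _ a1 b2; clear - C0 t t'; lra.
- have -> : g1 phi x * g2 phi x - g1 phi y * g2 phi y =
    g1 phi x * (g2 phi x - g2 phi y) + (g1 phi x - g1 phi y) * g2 phi y by ring.
  rewrite (le_trans (ler_normD _ _))//.
  have p1 := M _ _ _ _ a1 c2; have p2 := M _ _ _ _ c1 ay2.
  have p3 : 0 <= C1 * C2 * `|x - y| by exact: mulr_ge0.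
  by clear - p1 p2 p3; lra.
(* Leibniz' rule expanded at z: two linearisation errors and two products of increments, each
   quadratic in the distances between x, y and z. *)
- have -> : g1 phi x * g2 phi x - g1 phi y * g2 phi y -
      (dg1 phi z * g2 phi z + g1 phi z * dg2 phi z) * (x - y) =
    (g1 phi z * (g2 phi x - g2 phi y - dg2 phi z * (x - y)) +
      (g1 phi x - g1 phi z) * (g2 phi x - g2 phi y)) +
    ((g1 phi x - g1 phi y - dg1 phi z * (x - y)) * g2 phi z +
      (g1 phi x - g1 phi y) * (g2 phi y - g2 phi z)) by ring.
  rewrite (le_trans (ler_normD _ _))//.
  have n1 := ler_normD (g1 phi z * (g2 phi x - g2 phi y - dg2 phi z * (x - y)))
    ((g1 phi x - g1 phi z) * (g2 phi x - g2 phi y)).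
  have n2 := ler_normD ((g1 phi x - g1 phi y - dg1 phi z * (x - y)) * g2 phi z)
    ((g1 phi x - g1 phi y) * (g2 phi y - g2 phi z)).
  have m1 := M _ _ _ _ az1 d2; have m2 := M _ _ _ _ cxz1 c2.
  have m3 := M _ _ _ _ d1 az2; have m4 := M _ _ _ _ c1 cyz2.
  have p1 : 0 <= C1 * C2 * (`|x - z| * `|x - y|) by rewrite mulr_ge0// mulr_ge0.
  have p2 : 0 <= C1 * C2 * (`|y - z| * `|x - y|) by rewrite mulr_ge0// mulr_ge0.
  by clear - n1 n2 m1 m2 m3 m4 p1 p2; lra.
Qed.

Lemma tame_ext g1 dg1 g2 dg2 : (forall phi r, g1 phi r = g2 phi r) ->
  (forall phi r, dg1 phi r = dg2 phi r) -> tame g1 dg1 -> tame g2 dg2.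
Proof.
move=> e1 e2; have -> : g1 = g2 by apply/funext => ?; apply/funext.
by have -> : dg1 = dg2 by apply/funext => ?; apply/funext.
Qed.

Lemma tame_pow k : tame (fun _ r => r ^+ k) (fun _ r => k%:R * r ^+ k.-1).
Proof.
elim: k => [|k IH].
  apply: tame_ext (@tame_angle (fun=> 1) 1 _) => // *; first by rewrite mul0r.
  by rewrite normr1.
apply: tame_ext (tameM tame_radius IH) => phi r; first by rewrite exprS.
by case: k {IH} => [|k]; rewrite ?mulr0n //= -?natr1 ?exprS; ring.
Qed.

Lemma tame_sum (I : Type) (s : seq I) (g dg : I -> R -> R -> R) :
  (forall i, tame (g i) (dg i)) ->
  tame (fun phi r => \sum_(i <- s) g i phi r) (fun phi r => \sum_(i <- s) dg i phi r).
Proof.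
move=> H; elim: s => [|i s IH].
  apply: tame_ext (@tame_angle (fun=> 0) 0 _) => *; rewrite ?big_nil//.
  by rewrite normr0.
by apply: tame_ext (tameD (H i) IH) => phi r; rewrite big_cons.
Qed.

End Tame.

Section Radial.
Variables (R : realType) (N : nat) (h : nat -> R -> R).
Implicit Types (eps phi x y z r : R).

(* With x = r sin phi and y = r cos phi, the perturbation f(x) y + sgn(x) g(x, y)
   is r * polar_pert phi r, the angle phi has speed ang_speed, and the orbits
   solve dr/dphi = eps * slope eps phi r; slope0 is slope at eps = 0. *)
Definition polar_pert phi r := \sum_(k < N) h k phi * r ^+ k.
Definition polar_pert' phi r := \sum_(k < N) h k phi * (k%:R * r ^+ k.-1).
Definition slope0 phi r := - cos phi * (r * polar_pert phi r).
Definition slope0' phi r := - cos phi * (polar_pert phi r + r * polar_pert' phi r).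
Definition ang_speed eps phi r := 1 + eps * (sin phi * polar_pert phi r).
Definition slope eps phi r := slope0 phi r / ang_speed eps phi r.

Hypothesis bounded_h : exists M, forall k phi, `|h k phi| <= M.

(** Here [slope] equals [slope0 - eps * Q] with Q bounded and Lipschitz in the radius, so each bound
    for [slope] is the corresponding one for [slope0] up to a term of order eps. The third radius z
    is the fixed circle at which the averages will be taken. The choice of e0 keeps the angular
    speed within 1/2 of 1. *)
Lemma slope_estimates (rho : R) : exists C e0, [/\ 0 < C, 0 < e0 &
  forall eps phi x y z, `|eps| < e0 ->
  0 <= x <= rho -> 0 <= y <= rho -> 0 <= z <= rho ->
  [/\ 1 / 2 <= ang_speed eps phi x <= 2,
      `|slope eps phi x| <= C,
      `|slope eps phi x - slope0 phi z| <= C * (`|x - z| + `|eps|),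
      `|slope eps phi x - slope eps phi y| <= C * `|x - y| &
      `|slope eps phi x - slope eps phi y - slope0' phi z * (x - y)| <=
        C * ((`|x - z| + `|y - z| + `|eps|) * `|x - y|)]].
Proof.
have [M hM] := bounded_h.
have tv : tame rho polar_pert polar_pert'.
  apply: tame_sum => k.
  apply: tame_ext (tameM (tame_angle rho (hM k)) (tame_pow rho k)) => phi r //.
  by rewrite mul0r add0r.
have ts : tame rho slope0 slope0'.
  apply: tame_ext (tameM (@tame_angle _ rho (fun phi => - cos phi) 1 _)
    (tameM (tame_radius rho) tv)) => phi *.
  - by [].
  - by rewrite mul0r add0r mul1r.
  - by rewrite normrN cos_max.
have tT : tame rho (fun phi r => sin phi * polar_pert phi r)
    (fun phi r => sin phi * polar_pert' phi r).
  apply: tame_ext (tameM (@tame_angle _ rho sin 1 _) tv) => phi *.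
  - by [].
  - by rewrite mul0r add0r.
  - exact: sin_max.
have := tameM ts tT; set dP := (X in tame _ _ X); move=> tP.
have [Cs Cs0 Hs] := ts; have [CT CT0 HT] := tT; have [CP CP0 HP] := tP.
(* A Lipschitz constant of [Q] below: 4 bounds the product of two inverse angular speeds, and the
   rest bounds the numerator of the difference quotient for [|eps| <= 1]. *)
pose Z := 4 * (CP + 2 * (CP * CT)).
have CPT0 : 0 <= CP * CT by exact: mulr_ge0.
have CsT0 : 0 <= Cs * CT by exact: mulr_ge0.
have Z0 : 0 <= Z by rewrite /Z; clear - CP0 CPT0; lra.
have CT2 : 0 < 2 * (CT + 1) by clear - CT0; lra.
exists (2 * Cs + Cs * CT + Cs * CT + Z + 1), (1 / (2 * (CT + 1))); split.
- by clear - Cs0 CsT0 Z0; lra.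
- by rewrite divr_gt0.
move=> eps phi x y z epsl x0 y0 z0.
have [a1 b1 c1 d1] := Hs phi x y z x0 y0 z0.
have [_ _ cz1 _] := Hs phi x z z x0 z0 z0.
have [_ K1 _ _] := Hs phi z z z z0 z0 z0.
have [a2 b2 c2 d2] := HT phi x y z x0 y0 z0.
have [ay2 _ _ _] := HT phi y y z y0 y0 z0.
have [a3 b3 c3 d3] := HP phi x y z x0 y0 z0.
have [ay3 _ _ _] := HP phi y y z y0 y0 z0.
have epsCT : `|eps| * (CT + 1) <= 1 / 2.
  by have t := ltW epsl; rewrite ler_pdivlMr// in t; clear - t; lra.
have w12 r : `|sin phi * polar_pert phi r| <= CT -> 1 / 2 <= ang_speed eps phi r <= 2.
  move=> H; have : `|eps * (sin phi * polar_pert phi r)| <= 1 / 2.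
    by rewrite normrM (le_trans _ epsCT)// ler_wpM2l// (le_trans H)// lerDl.
  by rewrite ler_norml /ang_speed; clear; lra.
have wx := w12 x a2; have wy := w12 y ay2.
have eps1 : `|eps| <= 1.
  have epsCT0 : 0 <= `|eps| * CT by exact: mulr_ge0.
  by clear - epsCT0 epsCT; lra.
have iw r : 1 / 2 <= ang_speed eps phi r <= 2 -> `|(ang_speed eps phi r)^-1| <= 2.
  move=> w; have w0 : 0 < ang_speed eps phi r by clear - w; lra.
  by rewrite normfV gtr0_norm// -[leRHS]invrK lef_pV2 ?posrE ?invr_gt0//; clear - w; lra.
have M2 (p q a b : R) : `|p| <= a -> `|q| <= b -> `|p * q| <= a * b.
  by move=> pa qb; rewrite normrM ler_pM.
have wx0 : ang_speed eps phi x != 0 by apply: lt0r_neq0; clear - wx; lra.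
have wy0 : ang_speed eps phi y != 0 by apply: lt0r_neq0; clear - wy; lra.
pose Q r := slope0 phi r * (sin phi * polar_pert phi r) / ang_speed eps phi r.
have SE r : ang_speed eps phi r != 0 -> slope eps phi r = slope0 phi r - eps * Q r.
  by rewrite /Q /slope /ang_speed => w0; field.
have Qx : `|Q x| <= 2 * (Cs * CT).
  by rewrite /Q mulrC; apply: M2 (iw _ wx) (M2 _ _ _ _ a1 a2).
have QB : `|Q x - Q y| <= Z * `|x - y|.
  have -> : Q x - Q y =
    ((slope0 phi x * (sin phi * polar_pert phi x) -
      slope0 phi y * (sin phi * polar_pert phi y)) +
     eps * ((slope0 phi x * (sin phi * polar_pert phi x) -
      slope0 phi y * (sin phi * polar_pert phi y)) * (sin phi * polar_pert phi y) -
      slope0 phi y * (sin phi * polar_pert phi y) *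
       (sin phi * polar_pert phi x - sin phi * polar_pert phi y))) *
     ((ang_speed eps phi x)^-1 * (ang_speed eps phi y)^-1).
    by move: wx0 wy0; rewrite /Q /ang_speed => wx0 wy0; field; rewrite wx0 wy0.
  apply: (@le_trans _ _ ((CP + (CP * CT + CP * CT)) * `|x - y| * (2 * 2))); last first.
    by rewrite /Z le_eqVlt; apply/orP; left; apply/eqP; ring.
  refine (M2 _ _ _ _ _ (M2 _ _ _ _ (iw _ wx) (iw _ wy))).
  rewrite (le_trans (ler_normD _ _))// [leRHS]mulrDl lerD// -[leRHS]mul1r.
  refine (M2 _ _ _ _ eps1 _); rewrite (le_trans (ler_normB _ _))// [leRHS]mulrDl.
  by have t := M2 _ _ _ _ c3 ay2; have t' := M2 _ _ _ _ ay3 c2; clear - t t'; lra.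
have n0 := normr_ge0 (x - y); have n1 := normr_ge0 (x - z).
have n2 := normr_ge0 (y - z); have n3 := normr_ge0 eps.
split => //.
- rewrite /slope (le_trans (M2 _ _ _ _ a1 (iw _ wx)))//.
  by clear - CsT0 Z0; lra.
- rewrite (SE x)//.
  have -> : slope0 phi x - eps * Q x - slope0 phi z =
    (slope0 phi x - slope0 phi z) - eps * Q x by ring.
  rewrite (le_trans (ler_normB _ _))//.
  have q := M2 _ _ _ _ (lexx `|eps|) Qx.
  have u : 0 <= (Cs + 2 * (Cs * CT) + Z + 1) * `|x - z|.
    by apply: mulr_ge0 => //; clear - Cs0 CsT0 Z0; lra.
  have v : 0 <= (2 * Cs + Z + 1) * `|eps|.
    by apply: mulr_ge0 => //; clear - Cs0 Z0; lra.
  by clear - q u v cz1; lra.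
- rewrite (SE x)// (SE y)//.
  have -> : slope0 phi x - eps * Q x - (slope0 phi y - eps * Q y) =
    (slope0 phi x - slope0 phi y) - eps * (Q x - Q y) by ring.
  rewrite (le_trans (ler_normB _ _))//.
  have q := M2 _ _ _ _ eps1 QB; rewrite mul1r in q.
  have u : 0 <= (Cs + 2 * (Cs * CT) + 1) * `|x - y|.
    by apply: mulr_ge0 => //; clear - Cs0 CsT0; lra.
  by clear - q u c1; lra.
- rewrite (SE x)// (SE y)//.
  have -> : slope0 phi x - eps * Q x - (slope0 phi y - eps * Q y) -
      slope0' phi z * (x - y) =
    (slope0 phi x - slope0 phi y - slope0' phi z * (x - y)) - eps * (Q x - Q y) by ring.
  rewrite (le_trans (ler_normB _ _))//.
  have q := M2 _ _ _ _ (lexx `|eps|) QB.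
  have u : 0 <= (Cs + 2 * (Cs * CT) + Z + 1) * ((`|x - z| + `|y - z|) * `|x - y|).
    apply: mulr_ge0; first by clear - Cs0 CsT0 Z0; lra.
    by apply: mulr_ge0 => //; exact: addr_ge0.
  have v : 0 <= (2 * Cs + 2 * (Cs * CT) + 1) * (`|eps| * `|x - y|).
    by apply: mulr_ge0; [clear - Cs0 CsT0; lra|exact: mulr_ge0].
  by clear - q u v d1; lra.
Qed.
End Radial.

(** * Averaging *)

Section Mean.
Variable R : realType.
Implicit Types (f g u w A : R -> R) (a d m t x : R).
Notation tau := ((pi : R) *+ 2).

Lemma tau_gt0 : 0 < tau. Proof. by rewrite mulrn_wgt0// pi_gt0. Qed.

(* m is the integral of f over one period, not divided by its length. *)
Definition has_mean f m :=
  exists2 F, (forall t, is_derive t 1 F (f t)) & forall t, F (t + tau) = F t + m.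

Lemma is_derive_shiftr f w (T : R) t : (forall t, is_derive t 1 f (w t)) ->
  is_derive t 1 (fun s => f (s + T)) (w (t + T)).
Proof.
move=> df; have dT : is_derive t 1 (fun s : R => s + T) 1.
  by apply: is_derive_eq; rewrite addr0.
by have := @is_derive1_comp R f (fun s => s + T) t _ _ (df (t + T)) dT; rewrite mulr1.
Qed.

Lemma has_mean_periodic f : continuous f -> periodic f tau -> exists m, has_mean f m.
Proof.
move=> cf pf; have [F F0 dF] := antiderivative 0 cf.
exists (F tau), F => // t.
have D0 (s : R) : is_derive s 1 (fun s => F (s + tau) - F s) 0.
  rewrite -(subrr (f s)) -{1}(pf s).
  by apply: is_deriveB; exact: is_derive_shiftr.
have := is_derive_0_is_cst t 0 D0.
by rewrite /= add0r F0 subr0 => <-; ring.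
Qed.

Lemma has_meanD f g m m' : has_mean f m -> has_mean g m' ->
  has_mean (fun t => f t + g t) (m + m').
Proof.
move=> [F dF F1] [G dG G1]; exists (fun t => F t + G t) => t.
  exact: is_deriveD.
by rewrite F1 G1; ring.
Qed.

Lemma has_meanZ f m (k : R) : has_mean f m -> has_mean (fun t => k * f t) (k * m).
Proof.
move=> [F dF F1]; exists (fun t => k * F t) => t; last by rewrite F1 mulrDr.
exact: is_deriveZ.
Qed.

Lemma has_mean0 : has_mean (fun=> 0) 0.
Proof. by exists (fun=> 0) => t; rewrite ?addr0//; exact: is_derive_cst. Qed.

Lemma has_mean_sum (I : Type) (s : seq I) (f : I -> R -> R) (m : I -> R) :
  (forall i, has_mean (f i) (m i)) ->
  has_mean (fun t => \sum_(i <- s) f i t) (\sum_(i <- s) m i).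
Proof.
move=> H; elim: s => [|i s IH].
  rewrite big_nil (_ : (fun _ => _) = fun=> 0); first exact: has_mean0.
  by apply/funext => t; rewrite big_nil.
rewrite big_cons (_ : (fun _ => _) = fun t => f i t + \sum_(j <- s) f j t).
  exact: has_meanD.
by apply/funext => t; rewrite big_cons.
Qed.

Lemma mean_increment u w A m a d : (forall t, is_derive t 1 u (w t)) ->
  has_mean A m -> (forall t, a <= t <= a + tau -> `|w t - A t| <= d) ->
  `|u (a + tau) - u a - m| <= d * tau.
Proof.
move=> du [F dF F1] wA.
have dd (t : R) : is_derive t 1 (fun s => d * s) d.
  by apply: is_derive_eq; rewrite /GRing.scale /=; ring.
have duF t : is_derive t 1 (fun s => u s - F s) (w t - A t) by exact: is_deriveB.
have at0 : a <= a + tau by rewrite lerDl ltW// tau_gt0.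
have := derive_dominated duF dd at0 wA.
rewrite F1 -mulrBr; have -> : a + tau - a = tau by ring.
by have -> : u (a + tau) - (F a + m) - (u a - F a) = u (a + tau) - u a - m by ring.
Qed.

(** Each turn changes u by m up to an error smaller than the absolute value of m, so the values
    after whole turns are strictly monotone. *)
Lemma mean_no_return u w A m d (k : nat) a : (forall t, is_derive t 1 u (w t)) ->
  has_mean A m -> (forall t, `|w t - A t| <= d) -> d * tau < `|m| -> (0 < k)%N ->
  u (a + tau *+ k) <> u a.
Proof.
move=> du mA wA dm; have step b := mean_increment du mA (fun t (_ : b <= t <= b + tau) => wA t).
case: k => // k _; have [m0|m0] := leP 0 m.
- rewrite (ger0_norm m0) in dm.
  have up b : u b < u (b + tau) by have := step b; rewrite ler_norml => /andP[]; lra.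
  suff : u a < u (a + tau *+ k.+1) by move=> /lt_eqF/eqP/nesym.
  elim: k => [|k IH]; first by rewrite mulr1n.
  by apply: (lt_trans IH); rewrite [_ *+ k.+2]mulrSr addrA.
- rewrite (ltr0_norm m0) in dm.
  have dn b : u (b + tau) < u b by have := step b; rewrite ler_norml => /andP[]; lra.
  suff : u (a + tau *+ k.+1) < u a by move=> /lt_eqF/eqP.
  elim: k => [|k IH]; first by rewrite mulr1n.
  by apply: lt_trans IH; rewrite [_ *+ k.+2]mulrSr addrA.
Qed.

Lemma periodicz f (T : R) : periodic f T -> forall (z : int) a, f (a + T *~ z) = f a.
Proof.
move=> pf [n|n] a; first exact: periodicn.
by rewrite NegzE mulrNz -(periodicn pf n.+1) subrK.
Qed.

Lemma reduce_mod (T x : R) : 0 < T -> exists (z : int) y, 0 <= y < T /\ x = y + T *~ z.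
Proof.
move=> T0; exists (Num.floor (x / T)), (x - T *~ (Num.floor (x / T))).
split; last by rewrite subrK.
have Tz : T *~ Num.floor (x / T) = (Num.floor (x / T))%:~R * T by rewrite mulrzl.
have xT : x = x / T * T by rewrite divfK// gt_eqF.
rewrite Tz {1 3}xT -mulrBl; apply/andP; split.
  by rewrite pmulr_lge0// subr_ge0 floor_le.
by rewrite -[ltRHS]mul1r ltr_pM2r// ltrBlDl -intrD1 floorD1_gt.
Qed.

End Mean.

Lemma near_itv (R : realType) (x r e : R) :
  `|x - r| <= e -> e <= r -> 0 <= x <= 2 * r.
Proof. by rewrite ler_norml => ? ?; lra. Qed.

Section Averaging.
Variables (R : realType) (N : nat) (h : nat -> R -> R) (gam : nat -> R).
Hypothesis bounded_h : exists M, forall k phi, `|h k phi| <= M.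
Hypothesis mean_h : forall k, has_mean (fun phi => cos phi * h k phi) (gam k).
Implicit Types (eps phi r eta : R) (Rf : R -> R).
Notation tau := ((pi : R) *+ 2).
Notation P := (\poly_(k < N) gam k).

Lemma mean_slope0 r : has_mean (slope0 N h ^~ r) (- (r * P.[r])).
Proof.
have := has_mean_sum (index_enum 'I_N)
  (fun k : 'I_N => has_meanZ (- (r * r ^+ k)) (mean_h k)).
rewrite horner_poly mulr_sumr -sumrN.
under [X in has_mean _ X -> _]eq_bigr do rewrite mulNr mulrAC -mulrA.
rewrite (_ : (fun _ => _) = slope0 N h ^~ r)//; apply/funext => phi.
rewrite /slope0 /polar_pert !mulr_sumr; apply: eq_bigr => k _; ring.
Qed.

Lemma mean_slope0' r : has_mean (slope0' N h ^~ r) (- (P.[r] + r * P^`().[r])).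
Proof.
have := has_mean_sum (index_enum 'I_N)
  (fun k : 'I_N => has_meanZ (- (r ^+ k + r * (k%:R * r ^+ k.-1))) (mean_h k)).
rewrite (_ : - (P.[r] + _) =
    \sum_(k < N) - (r ^+ k + r * (k%:R * r ^+ k.-1)) * gam k); last first.
  rewrite horner_poly poly_def raddf_sum horner_sum /= mulr_sumr -big_split -sumrN.
  apply: eq_bigr => k _; rewrite derivZ derivXn hornerZ hornerMn hornerXn /=.
  by rewrite -[_ *+ k]mulr_natl; ring.
rewrite (_ : (fun _ => _) = slope0' N h ^~ r)//; apply/funext => phi.
rewrite /slope0' /polar_pert /polar_pert' mulr_sumr -big_split /=.
by rewrite mulr_sumr; apply: eq_bigr => k _; ring.
Qed.

Definition slope_solution eps Rf :=
  forall phi, is_derive phi 1 Rf (eps * slope N h eps phi (Rf phi)).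

Lemma small_times (C m : R) : 0 < C -> 0 < m -> exists2 d, 0 < d & C * d * tau < m.
Proof.
move=> C0 m0; have := tau_gt0 R; move: tau => T T0; exists (m / (2 * C * T)).
  by rewrite divr_gt0// !mulr_gt0.
have -> : C * (m / (2 * C * T)) * T = m / 2.
  by field; rewrite !lt0r_neq0.
lra.
Qed.

Lemma no_periodic_slope_solution r : 0 < r -> P.[r] != 0 ->
  exists eta e0, [/\ 0 < eta, 0 < e0 & forall eps Rf k, 0 < `|eps| < e0 ->
    slope_solution eps Rf -> (forall phi, `|Rf phi - r| < eta) -> (0 < k)%N ->
    Rf (0 + tau *+ k) <> Rf 0].
Proof.
move=> r0 Pr; have [C [e1 [C0 e10 est]]] := slope_estimates N bounded_h (2 * r).
have m0 : 0 < `|- (r * P.[r])| by rewrite normr_gt0 oppr_eq0 mulf_neq0// gt_eqF.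
(* The 2 accounts for the two errors, the distance to r and [|eps|], each below d. *)
have C2 : 0 < 2 * C by rewrite mulr_gt0.
have rr : 0 <= r <= 2 * r by apply: (@near_itv _ r r 0); rewrite ?subrr ?normr0// ltW.
have [d d0 dm] := small_times C2 m0.
exists (Num.min r d), (Num.min e1 d); rewrite !lt_min r0 d0 e10; split => // eps Rf k.
rewrite lt_min => /and3P[eps0 epse epsd] sol Rr k0.
have {}Rr phi : `|Rf phi - r| < r /\ `|Rf phi - r| < d.
  by have := Rr phi; rewrite lt_min => /andP[].
apply: (@mean_no_return R _ _ _ (eps * - (r * P.[r])) (`|eps| * (2 * C * d)) k _ sol).
- exact: has_meanZ (mean_slope0 r).
- move=> phi; have [R1 R2] := Rr phi.
  rewrite -mulrBr normrM ler_wpM2l//.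
  have [_ _ H _ _] := est eps phi _ _ _ epse (near_itv (ltW R1) (lexx r)) rr rr.
  by rewrite (le_trans H)// [2 * C]mulrC -mulrA ler_pM2l//; clear - R2 epsd; lra.
- by rewrite normrM -[ltLHS]mulrA ltr_pM2l.
- exact: k0.
Qed.

Lemma unique_periodic_slope_solution r : 0 < r -> P.[r] = 0 -> P^`().[r] != 0 ->
  exists eta e0, [/\ 0 < eta, 0 < e0 & forall eps R1 R2 k1 k2, 0 < `|eps| < e0 ->
    slope_solution eps R1 -> (forall phi, `|R1 phi - r| < eta) ->
    slope_solution eps R2 -> (forall phi, `|R2 phi - r| < eta) ->
    periodic R1 (tau *+ k1) -> periodic R2 (tau *+ k2) -> (0 < k1)%N -> (0 < k2)%N ->
    R1 = R2].
Proof.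
move=> r0 Pr P'r; have [C [e1 [C0 e10 est]]] := slope_estimates N bounded_h (2 * r).
have m0 : 0 < `|2 * - (P.[r] + r * P^`().[r])|.
  by rewrite normr_gt0 mulf_neq0 ?pnatr_eq0// oppr_eq0 Pr add0r mulf_neq0// gt_eqF.
(* 6 is 2 times 3: the 2 comes from differentiating a square, the 3 from the two distances to r and
   [|eps|], each below d. *)
have C6 : 0 < 6 * C by rewrite mulr_gt0.
have rr : 0 <= r <= 2 * r by apply: (@near_itv _ r r 0); rewrite ?subrr ?normr0// ltW.
have [d d0 dm] := small_times C6 m0.
exists (Num.min r d), (Num.min e1 d); rewrite !lt_min r0 d0 e10; split => //.
move=> eps R1 R2 k1 k2.
rewrite lt_min => /and3P[eps0 epse epsd] sol1 R1r sol2 R2r per1 per2 k10 k20.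
have {}R1r phi : `|R1 phi - r| < r /\ `|R1 phi - r| < d.
  by have := R1r phi; rewrite lt_min => /andP[].
have {}R2r phi : `|R2 phi - r| < r /\ `|R2 phi - r| < d.
  by have := R2r phi; rewrite lt_min => /andP[].
pose U phi := (R1 phi - R2 phi) * (R1 phi - R2 phi).
pose W phi := 2 * (R1 phi - R2 phi) *
  (eps * slope N h eps phi (R1 phi) - eps * slope N h eps phi (R2 phi)).
have dU phi : is_derive phi 1 U (W phi).
  have dD := is_deriveB (sol1 phi) (sol2 phi).
  by apply: is_derive_eq (is_deriveM dD dD) _; rewrite /W /GRing.scale /= !fctE; ring.
have U0 phi : 0 <= U phi by rewrite /U -expr2 sqr_ge0.
have key phi : `|W phi - 2 * eps * slope0' N h phi r * U phi| <=
    `|eps| * (6 * C * d) * U phi.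
  have [a1 a2] := R1r phi; have [b1 b2] := R2r phi.
  have [_ _ _ _ H] := est eps phi _ _ _ epse (near_itv (ltW a1) (lexx r))
    (near_itv (ltW b1) (lexx r)) rr.
  have -> : W phi - 2 * eps * slope0' N h phi r * U phi =
    2 * eps * (R1 phi - R2 phi) * (slope N h eps phi (R1 phi) -
      slope N h eps phi (R2 phi) - slope0' N h phi r * (R1 phi - R2 phi)).
    by rewrite /W /U; ring.
  rewrite normrM.
  apply: (le_trans (ler_wpM2l (normr_ge0 _) H)).
  have -> : U phi = `|R1 phi - R2 phi| * `|R1 phi - R2 phi|.
    by rewrite -normrM (ger0_norm (U0 phi)).
  rewrite !normrM (ger0_norm (ler0n _ 2)).
  set D := `|R1 phi - R2 phi|.
  have -> : 2 * `|eps| * D * (C * ((`|R1 phi - r| + `|R2 phi - r| + `|eps|) * D)) =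
    (2 * C * `|eps| * (D * D)) * (`|R1 phi - r| + `|R2 phi - r| + `|eps|) by ring.
  have -> : `|eps| * (6 * C * d) * (D * D) = (2 * C * `|eps| * (D * D)) * (3 * d) by ring.
  apply: ler_wpM2l; last by clear - a2 b2 epsd; lra.
  have D0 : 0 <= D := normr_ge0 _; have C0' := ltW C0.
  by apply: mulr_ge0; apply: mulr_ge0 => //; apply: mulr_ge0.
have WL phi : `|W phi| <= 2 * `|eps| * C * U phi.
  have [a1 a2] := R1r phi; have [b1 b2] := R2r phi.
  have [_ _ _ H _] := est eps phi _ _ _ epse (near_itv (ltW a1) (lexx r))
    (near_itv (ltW b1) (lexx r)) rr.
  rewrite /W -mulrBr !normrM (ger0_norm (ler0n _ 2)).
  have -> : U phi = `|R1 phi - R2 phi| * `|R1 phi - R2 phi|.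
    by rewrite -normrM (ger0_norm (U0 phi)).
  have nn : 0 <= 2 * `|eps| * `|R1 phi - R2 phi| by rewrite !mulr_ge0.
  by have t := ler_wpM2l nn H; clear - t; lra.
(* Solutions that meet once coincide by Gronwall; otherwise [ln (U t)] is defined for all t. *)
have [|Upos] := pselect (exists phi, U phi = 0).
  move=> [phi Up]; apply/funext => psi.
  have := gronwall dU (fun t (_ : Num.min phi psi <= t <= Num.max phi psi) => WL t).
  rewrite Up mul0r => Upsi.
  have : U psi == 0 by rewrite eq_le Upsi U0.
  by rewrite mulf_eq0 orbb subr_eq0 => /eqP.
have {}Upos phi : 0 < U phi.
  by rewrite lt0r U0 andbT; apply/eqP => H; apply: Upos; exists phi.
have dlnU phi : is_derive phi 1 (fun t => ln (U t)) (W phi / U phi).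
  have := @is_derive1_comp R (@ln R) U phi _ _ (is_derive1_ln (Upos phi)) (dU phi).
  by rewrite mulrC.
(* Over one period ln U changes by about 2 eps times the mean of slope0', which is
   not zero, so that U cannot return to its initial value. *)
exfalso.
apply: (@mean_no_return R (fun t => ln (U t)) _ _
  (eps * (2 * - (P.[r] + r * P^`().[r]))) (`|eps| * (6 * C * d)) (k1 * k2) 0 dlnU).
- exact: has_meanZ (has_meanZ 2 (mean_slope0' r)).
- move=> phi; rewrite -(ler_pM2r (Upos phi)) -{2}(ger0_norm (U0 phi)) -normrM.
  apply: le_trans (key phi); rewrite mulrBl divfK ?gt_eqF//.
  by have -> : eps * (2 * slope0' N h phi r) * U phi =
     2 * eps * slope0' N h phi r * U phi by ring.
- by rewrite normrM -[ltLHS]mulrA ltr_pM2l.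
- by rewrite muln_gt0 k10.
(* The two solutions may close up after different numbers of turns; [k1 * k2] turns suit both. *)
- have E1 : R1 (0 + tau *+ (k1 * k2)) = R1 0 by rewrite mulrnA periodicn.
  have E2 : R2 (0 + tau *+ (k1 * k2)) = R2 0 by rewrite mulnC mulrnA periodicn.
  by rewrite /U E1 E2.
Qed.

End Averaging.

(** * Truncation of the radius and global solutions *)

Section Clamp.
Variable R : realType.
Implicit Types x y rho : R.

(** Evaluating the slope at the truncated radius makes the radial equation globally bounded and
    Lipschitz; solutions staying in [0, rho] solve the original equation. *)
Definition clamp rho x := Num.max 0 (Num.min x rho).

Lemma clamp_itv rho x : 0 <= rho -> 0 <= clamp rho x <= rho.
Proof. by move=> ?; rewrite /clamp; case: (leP x rho) => ?; [case: (leP 0 x)|case: (leP 0 rho)] => ?; lra. Qed.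

Lemma clamp_id rho x : 0 <= x <= rho -> clamp rho x = x.
Proof. by move=> ?; rewrite /clamp; case: (leP x rho) => ?; [case: (leP 0 x)|case: (leP 0 rho)] => ?; lra. Qed.

Lemma clamp_lipschitz rho x y : 0 <= rho -> `|clamp rho x - clamp rho y| <= `|x - y|.
Proof.
move=> ?; rewrite ler_norml /clamp.
have := ler_norm (x - y); have := ler_norm (- (x - y)); rewrite normrN => ? ?.
case: (leP x rho) => ?; [case: (leP 0 x)|case: (leP 0 rho)] => ?;
  (case: (leP y rho) => ?; [case: (leP 0 y)|case: (leP 0 rho)] => ?); lra.
Qed.

Lemma clamp_continuous rho : 0 <= rho -> continuous (clamp rho).
Proof.
move=> r0 x; apply/cvgrPdist_lt => e e0; near=> y.
apply: le_lt_trans (clamp_lipschitz x y r0) _.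
by near: y; apply: cvgr_dist_lt e0; exact: cvg_id.
Unshelve. all: by end_near. Qed.

End Clamp.

Section Flow.
Variables (R : realType) (N : nat) (h : nat -> R -> R).
Hypothesis bounded_h : exists M, forall k phi, `|h k phi| <= M.
Hypothesis cont_h : forall k, continuous (h k).
Implicit Types (eps phi r eta : R) (Rf c : R -> R).
Notation tau := ((pi : R) *+ 2).

Lemma polar_pert_continuous c : continuous c -> continuous (fun t => polar_pert N h t (c t)).
Proof.
move=> cc; apply: continuous_big => [|k _ t]; first exact: add_continuous.
apply: cvgM; first exact: cont_h.
by apply: (@continuous_comp _ _ _ c (fun x => x ^+ k)); [exact: cc|exact: exprn_continuous].
Qed.

Lemma ang_speed_continuous eps c : continuous c ->
  continuous (fun t => ang_speed N h eps t (c t)).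
Proof.
move=> cc t; apply: cvgD; first exact: cvg_cst.
apply: cvgM; first exact: cvg_cst.
apply: cvgM; first exact: continuous_sin.
exact: polar_pert_continuous.
Qed.

Lemma slope_continuous eps c : continuous c ->
  (forall t, ang_speed N h eps t (c t) != 0) ->
  continuous (fun t => slope N h eps t (c t)).
Proof.
move=> cc w0 t; apply: cvgM; last first.
  by apply: cvgV => //; exact: ang_speed_continuous.
apply: cvgM; first by apply: cvgN; exact: continuous_cos.
by apply: cvgM; [exact: cc|exact: polar_pert_continuous].
Qed.

Lemma clamped_solution rho : 0 < rho -> exists2 e0, 0 < e0 &
  forall eps phi0 r0, `|eps| < e0 -> exists2 Rf, Rf phi0 = r0 &
    forall phi, is_derive phi 1 Rf (eps * slope N h eps phi (clamp rho (Rf phi))).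
Proof.
move=> rho0; have [C [e0 [C0 e00 est]]] := slope_estimates N bounded_h rho.
exists e0 => // eps phi0 r0 epse.
have cl x : 0 <= clamp rho x <= rho by apply: clamp_itv; exact: ltW.
(* The added 1 keeps the Lipschitz constant positive when eps is 0. *)
have L0 : 0 < `|eps| * C + 1 by rewrite ltr_wpDl// mulr_ge0// ltW.
apply: (@picard R (fun phi x => eps * slope N h eps phi (clamp rho x))
  (`|eps| * C + 1) (`|eps| * C) phi0 r0 L0).
- move=> c cc t; apply: cvgM; first exact: cvg_cst.
  apply: (@slope_continuous eps (fun t => clamp rho (c t))) => s.
    apply: (@continuous_comp _ _ _ c (clamp rho)); first exact: cc.
    by apply: clamp_continuous; exact: ltW.
  have [w _ _ _ _] := est eps s _ _ _ epse (cl (c s)) (cl (c s)) (cl (c s)).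
  by apply: lt0r_neq0; lra.
- move=> t x y; rewrite -mulrBr normrM.
  have [_ _ _ H _] := est eps t _ _ _ epse (cl x) (cl y) (cl y).
  have := ler_wpM2l (normr_ge0 eps) H.
  have := clamp_lipschitz x y (ltW rho0).
  move=> /(ler_wpM2l (_ : 0 <= `|eps| * C)); rewrite mulr_ge0 ?(ltW C0)// => /(_ isT).
  have := normr_ge0 (x - y); lra.
- move=> t x; rewrite normrM ler_wpM2l//.
  by have [_ H _ _ _] := est eps t _ _ _ epse (cl x) (cl x) (cl x).
Qed.

End Flow.

(** * Periodic solutions near a simple root *)

Section Existence.
Variable R : realType.
Notation tau := ((pi : R) *+ 2).

(** Write P = Q (X - r). Then Q(r) = P'(r) is nonzero, Q keeps its sign near r, and P(r - d) P(r +
    d) = - d^2 Q(r - d) Q(r + d). *)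
Lemma simple_root_sign_change (P : {poly R}) (r eta : R) : P.[r] = 0 -> P^`().[r] != 0 ->
  0 < eta -> exists2 d, 0 < d < eta & P.[r - d] * P.[r + d] < 0.
Proof.
move=> /eqP/factor_theorem[Q PQ] P'r eta0.
have Qr : P^`().[r] = Q.[r] by rewrite PQ derivM derivB derivX derivC !hornerE subrr mulr0 add0r ?subr0 ?mulr1.
rewrite Qr in P'r.
have /cvgrPdist_lt /(_ `|Q.[r]|) := is_derive_continuous_at (is_derive_poly Q r).
rewrite normr_gt0 => /(_ P'r) /nbhs_ballP [d0 /= d00 Hd].
have sgn x : `|x - r| < d0 -> 0 < Q.[r] * Q.[x].
  move=> xr; have {Hd} := Hd x; rewrite /ball /= distrC => /(_ xr).
  have [Q0|Q0|Q0] := ltgtP 0 Q.[r]; last by rewrite -Q0 eqxx in P'r.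
  - by rewrite (gtr0_norm Q0) ltr_norml => /andP[? ?]; apply: mulr_gt0 => //; lra.
  - by rewrite (ltr0_norm Q0) ltr_norml => /andP[? ?]; rewrite nmulr_rgt0//; lra.
exists (Num.min eta d0 / 2); first by case: (leP eta d0) => ?; lra.
set d := _ / 2.
have dd : 0 < d < d0 by rewrite /d; case: (leP eta d0) => ?; lra.
have H1 : 0 < Q.[r] * Q.[r - d].
  by apply: sgn; rewrite addrAC subrr add0r normrN gtr0_norm; lra.
have H2 : 0 < Q.[r] * Q.[r + d].
  by apply: sgn; rewrite addrAC subrr add0r gtr0_norm; lra.
have H3 := mulr_gt0 H1 H2.
have -> : P.[r - d] * P.[r + d] = - (d * d * (Q.[r - d] * Q.[r + d])).
  by rewrite PQ !hornerM !hornerXsubC; ring.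
rewrite oppr_lt0; apply: mulr_gt0; first by apply: mulr_gt0; lra.
have Q2 : 0 < Q.[r] * Q.[r] by rewrite -expr2 exprn_even_gt0.
by rewrite -(pmulr_rgt0 _ Q2); move: H3; congr (0 < _); ring.
Qed.

Lemma same_sign_near (x y : R) : `|x - y| < `|y| -> 0 < x * y.
Proof.
have [y0|y0|<-] := ltgtP 0 y; last by rewrite normr0 normr_lt0.
- by rewrite (gtr0_norm y0) ltr_norml => /andP[? _]; rewrite pmulr_lgt0//; lra.
- by rewrite (ltr0_norm y0) ltr_norml => /andP[_ ?]; rewrite nmulr_lgt0//; lra.
Qed.

Lemma gronwall_distance (u1 u2 w1 w2 : R -> R) (L a b : R) :
  (forall t : R, is_derive t 1 u1 (w1 t)) -> (forall t : R, is_derive t 1 u2 (w2 t)) ->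
  (forall t, `|w1 t - w2 t| <= L * `|u1 t - u2 t|) ->
  (u1 b - u2 b) ^+ 2 <= (u1 a - u2 a) ^+ 2 * expR (2 * L * `|b - a|).
Proof.
move=> d1 d2 wL; rewrite !expr2.
apply: (@gronwall R (fun t => (u1 t - u2 t) * (u1 t - u2 t))
  (fun t => 2 * (u1 t - u2 t) * (w1 t - w2 t))).
- move=> t; have dD := is_deriveB (d1 t) (d2 t).
  by apply: is_derive_eq (is_deriveM dD dD) _; rewrite /GRing.scale /= !fctE; ring.
- move=> t _.
  have -> : (u1 t - u2 t) * (u1 t - u2 t) = `|u1 t - u2 t| * `|u1 t - u2 t|.
    by rewrite -normrM ger0_norm// -expr2 sqr_ge0.
  rewrite !normrM (ger0_norm (ler0n _ 2)).
  by have := ler_wpM2l (normr_ge0 (u1 t - u2 t)) (wL t); lra.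
Qed.

Variables (N : nat) (h : nat -> R -> R) (gam : nat -> R).
Hypothesis bounded_h : exists M, forall k phi, `|h k phi| <= M.
Hypothesis cont_h : forall k, continuous (h k).
Hypothesis per_h : forall k, periodic (h k) tau.
Hypothesis mean_h : forall k, has_mean (fun phi => cos phi * h k phi) (gam k).
Notation P := (\poly_(k < N) gam k).

Lemma polar_pert_periodic r : periodic (polar_pert N h ^~ r) tau.
Proof. by move=> phi; apply: eq_bigr => k _; rewrite per_h. Qed.

Lemma ang_speed_periodic eps r : periodic (ang_speed N h eps ^~ r) tau.
Proof. by move=> phi; rewrite /ang_speed polar_pert_periodic sinD2pi. Qed.

Lemma slope_periodic eps r : periodic (slope N h eps ^~ r) tau.
Proof.
by move=> phi; rewrite /slope /slope0 polar_pert_periodic cosD2pi ang_speed_periodic.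
Qed.

(** The intermediate value theorem is applied to the displacement after one turn as a function of
    the initial radius. For this the truncated equation is solved from every initial radius, and the
    truncation is removed only for the periodic solution found. *)
Lemma exists_periodic_slope_solution r eta : 0 < r -> P.[r] = 0 -> P^`().[r] != 0 ->
  0 < eta -> exists2 e0, 0 < e0 & forall eps, 0 < `|eps| < e0 ->
  exists Rf, [/\ slope_solution N h eps Rf, forall phi, `|Rf phi - r| < eta &
    periodic Rf tau].
Proof.
move=> r0 Pr P'r eta0.
wlog etar : eta eta0 / eta <= r.
  move=> /(_ (Num.min eta r)); rewrite lt_min eta0 r0 ge_min lexx orbT => /(_ isT isT).
  move=> [e0 e00 H]; exists e0 => // eps /H[Rf [sol Rr per]]; exists Rf; split => // phi.
  by have := Rr phi; rewrite lt_min => /andP[].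
have r20 : 0 < 2 * r by rewrite mulr_gt0.
have [C [e1 [C0 e10 est]]] := slope_estimates N bounded_h (2 * r).
have [e2 e20 clsol] := clamped_solution N bounded_h cont_h r20.
have t0 := tau_gt0 R.
have eta2 : 0 < eta / 2 by rewrite divr_gt0.
have [d /andP[d0 deta] dsign] := simple_root_sign_change Pr P'r eta2.
pose m x := - (x * P.[x]).
have mab : m (r - d) * m (r + d) < 0.
  have -> : m (r - d) * m (r + d) = (r - d) * (r + d) * (P.[r - d] * P.[r + d]).
    by rewrite /m; ring.
  by rewrite pmulr_rlt0// mulr_gt0//; clear - deta etar d0 r0; lra.
have [ma0 mb0] : m (r - d) != 0 /\ m (r + d) != 0.
  by apply/andP; rewrite -negb_or -mulf_eq0 lt_eqF.
have mm : 0 < Num.min `|m (r - d)| `|m (r + d)| by rewrite lt_min !normr_gt0 ma0.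
(* During a turn the radius drifts by at most [|eps| * C * tau]; adding the [|eps|] of the slope
   estimate, the slope differs from [slope0] at the initial radius by at most
   [C * (C * tau + 1) * |eps|]. *)
have CC : 0 < C * (C * tau + 1) by apply: mulr_gt0 => //; rewrite ltr_wpDl// mulr_ge0// ltW.
have [e3 e30 He3] := small_times CC mm.
have [e4 e40 He4] := small_times C0 eta2.
exists (Num.min (Num.min e1 e2) (Num.min e3 e4)); first by rewrite !lt_min e10 e20 e30.
move=> eps; rewrite !lt_min => /andP[eps0 /andP[/andP[epse1 epse2] /andP[epse3 epse4]]].
have epsn0 : eps != 0 by rewrite -normr_gt0.
have cl x : 0 <= clamp (2 * r) x <= 2 * r by apply: clamp_itv; exact: ltW.
have /choice[S SP] : forall rho, exists Rf : R -> R, Rf 0 = rho /\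
    forall phi : R, is_derive phi 1 Rf (eps * slope N h eps phi (clamp (2 * r) (Rf phi))).
  by move=> rho; have [Rf] := clsol eps 0 rho epse2; exists Rf.
have S0 rho : S rho 0 = rho by have [] := SP rho.
have dS rho := (SP rho).2.
have lipS (u1 u2 : R) t : `|eps * slope N h eps t (clamp (2 * r) u1) -
    eps * slope N h eps t (clamp (2 * r) u2)| <= (`|eps| * C) * `|u1 - u2|.
  have [_ _ _ H _] := est eps t _ _ _ epse1 (cl u1) (cl u2) (cl u2).
  rewrite -mulrBr normrM -mulrA ler_wpM2l// (le_trans H)// ler_pM2l//.
  by apply: clamp_lipschitz; exact: ltW.
have Sclose rho phi : 0 <= phi <= tau -> `|S rho phi - rho| <= `|eps| * C * tau.
  move=> /andP[phi0 phit].
  have dlin (t : R) : is_derive t 1 (fun s => `|eps| * C * s) (`|eps| * C).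
    by apply: is_derive_eq; rewrite /GRing.scale /=; ring.
  have := derive_dominated (dS rho) dlin phi0; rewrite S0 mulr0 subr0 => H.
  apply: (le_trans (H _)); last by rewrite ler_wpM2l// mulr_ge0// ltW.
  move=> t _; rewrite normrM ler_wpM2l//.
  by have [_ + _ _ _] := est eps t _ _ _ epse1 (cl (S rho t)) (cl 0) (cl 0).
have epsCt : `|eps| * C * tau < eta / 2.
  apply: le_lt_trans He4; rewrite ler_pM2r// mulrC ler_pM2l//; exact: ltW.
have Sr rho phi : `|rho - r| <= d -> 0 <= phi <= tau -> `|S rho phi - r| < eta.
  move=> rhod phit; have H := Sclose rho phi phit.
  rewrite -(subrK rho (S rho phi)) -addrA (le_lt_trans (ler_normD _ _))//.
  by clear - rhod H deta epsCt; lra.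
have disp rho : `|rho - r| <= d -> `|S rho tau - rho - eps * m rho| <
    `|eps| * Num.min `|m (r - d)| `|m (r + d)|.
  move=> rhod.
  have := @mean_increment R _ _ _ _ 0 (`|eps| * (C * (`|eps| * C * tau + `|eps|)))
    (dS rho) (has_meanZ eps (@mean_slope0 R N h gam mean_h rho)).
  rewrite add0r S0 => H; apply: (le_lt_trans (H _)).
  - move=> t tt; rewrite -mulrBr normrM ler_wpM2l//.
    have Hr : 0 <= rho <= 2 * r by apply: near_itv rhod _; clear - deta eta0 etar; lra.
    have HS' := near_itv (ltW (Sr rho t rhod tt)) etar; rewrite clamp_id//.
    have [_ _ K _ _] := est eps t _ _ _ epse1 HS' Hr Hr.
    by apply: (le_trans K); rewrite ler_pM2l// lerD2r; exact: Sclose.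
  - rewrite -[ltLHS]mulrA ltr_pM2l//; apply: le_lt_trans He3.
    rewrite ler_pM2r//.
    have -> : C * (`|eps| * C * tau + `|eps|) = C * (C * tau + 1) * `|eps| by ring.
    by rewrite ler_pM2l//; exact: ltW.
have sgn rho : `|rho - r| <= d -> Num.min `|m (r - d)| `|m (r + d)| <= `|m rho| ->
    0 < (S rho tau - rho) * (eps * m rho).
  move=> rhod mrho; apply: same_sign_near; apply: (lt_le_trans (disp rho rhod)).
  by rewrite normrM ler_wpM2l.
have d_abs : `|d| <= d by rewrite gtr0_norm.
have sa : 0 < (S (r - d) tau - (r - d)) * (eps * m (r - d)).
  by apply: sgn; [rewrite addrAC subrr add0r normrN|rewrite ge_min lexx].
have sb : 0 < (S (r + d) tau - (r + d)) * (eps * m (r + d)).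
  by apply: sgn; [rewrite addrAC subrr add0r|rewrite ge_min lexx orbT].
pose D rho := S rho tau - rho.
have Dab : D (r - d) * D (r + d) < 0.
  have := mulr_gt0 sa sb; rewrite -/(D (r - d)) -/(D (r + d)).
  have -> : D (r - d) * (eps * m (r - d)) * (D (r + d) * (eps * m (r + d))) =
    (D (r - d) * D (r + d)) * (eps ^+ 2 * (m (r - d) * m (r + d))) by ring.
  by rewrite nmulr_lgt0// pmulr_rlt0// exprn_even_gt0.
have cD : continuous D.
  move=> x; apply: cvgB; last exact: cvg_id.
  pose K := expR (2 * (`|eps| * C) * `|tau - 0|).
  have K1 : 1 <= K.
    rewrite -[leLHS]expR0 ler_expR; apply: mulr_ge0 => //; apply: mulr_ge0 => //.
    by apply: mulr_ge0 => //; exact: ltW.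
  apply/cvgrPdist_lt => e e0; near=> y.
  have := @gronwall_distance _ _ _ _ (`|eps| * C) 0 tau (dS x) (dS y)
    (fun t => lipS _ _ t).
  rewrite -/K !S0 => H.
  have : `|S x tau - S y tau| <= `|x - y| * K.
    rewrite -ler_sqr ?nnegrE ?mulr_ge0 ?(le_trans ler01 K1)//.
    rewrite exprMn !real_normK ?num_real// (le_trans H)// ler_wpM2l ?sqr_ge0//.
    by rewrite expr2 ler_peMl// (le_trans ler01 K1).
  move=> /le_lt_trans; apply; rewrite -ltr_pdivlMr ?(lt_le_trans ltr01 K1)//.
  near: y; apply: cvgr_dist_lt; first exact: cvg_id.
  by rewrite divr_gt0// (lt_le_trans ltr01 K1).
(* The displacement D changes sign because it is close to eps * m. *)
have [rho rhoab Drho] : exists2 rho, rho \in `[r - d, r + d] & D rho = 0.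
  have ab : r - d <= r + d by rewrite lerD2l (@le_trans _ _ 0) ?oppr_le0 ?ltW.
  apply: (IVT ab); first exact: continuous_subspaceT.
  rewrite ge_min le_max.
  have [Da|Da|Da] := ltgtP 0 (D (r - d)).
  - by move: Dab; rewrite pmulr_rlt0// => /ltW ->; rewrite ?orbT.
  - by move: Dab; rewrite nmulr_rlt0// => /ltW ->; rewrite ?orbT.
  - by move: Dab; rewrite -Da mul0r ltxx.
have rhod : `|rho - r| <= d.
  by move: rhoab; rewrite in_itv/= ler_distl.
(* The solution shifted by one turn solves the same equation with the same initial value, so
   Gronwall identifies the two. *)
have per : periodic (S rho) tau.
  move=> phi.
  have dshift (t : R) : is_derive t 1 (fun s => S rho (s + tau))
      (eps * slope N h eps t (clamp (2 * r) (S rho (t + tau)))).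
    by rewrite -slope_periodic; exact: is_derive_shiftr.
  have := @gronwall_distance _ _ _ _ (`|eps| * C) 0 phi dshift (dS rho)
    (fun t => lipS _ _ t).
  have -> : S rho (0 + tau) - S rho 0 = 0 by rewrite add0r S0.
  rewrite expr0n mul0r => H.
  have : (S rho (phi + tau) - S rho phi) ^+ 2 == 0 by rewrite eq_le H sqr_ge0.
  by rewrite sqrf_eq0 subr_eq0 => /eqP.
(* Periodicity extends the bound known on the first turn to all angles, and then [clamp] acts as the
   identity. *)
have near_r phi : `|S rho phi - r| < eta.
  have [z [y [/andP[y0 yt] ->]]] := reduce_mod phi t0.
  by rewrite (periodicz per); apply: Sr => //; rewrite y0 ltW.
exists (S rho); split => // phi.
by have := dS rho phi; rewrite clamp_id// (near_itv (ltW (near_r phi)) etar).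
Unshelve. all: by end_near. Qed.

End Existence.

(** * Orbits of the planar system *)

Section PolarToPlanar.
Variables (R : realType) (N : nat) (h : nat -> R -> R).
Hypothesis bounded_h : exists M, forall k phi, `|h k phi| <= M.
Hypothesis cont_h : forall k, continuous (h k).
Implicit Types (eps phi r t s : R) (Rf theta : R -> R) (F : R * R -> R * R).
Notation tau := ((pi : R) *+ 2).

Definition polar_curve Rf phi := (Rf phi * sin phi, Rf phi * cos phi).

(** [F] is left abstract so that the same lemmas serve the continuous planar field and each of the
    smooth fields X and Y, with their own coefficients [h]. *)
Definition polar_field eps F := forall phi r, 0 < r ->
  F (r * sin phi, r * cos phi) =
    (r * cos phi, - (r * sin phi) - eps * (r * polar_pert N h phi r)).

Lemma is_derive_sin_comp theta t l : is_derive t 1 theta l ->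
  is_derive t 1 (fun s => sin (theta s)) (l * cos (theta t)).
Proof.
move=> d; rewrite mulrC.
exact: (@is_derive1_comp R (@sin R) theta t _ l (is_derive_sin _)).
Qed.

Lemma is_derive_cos_comp theta t l : is_derive t 1 theta l ->
  is_derive t 1 (fun s => cos (theta s)) (- (l * sin (theta t))).
Proof.
move=> d; rewrite mulrC -mulNr.
exact: (@is_derive1_comp R (@cos R) theta t _ l (is_derive_cos _)).
Qed.

Lemma polar_has_velocity eps F Rf theta t : polar_field eps F ->
  0 < Rf (theta t) -> ang_speed N h eps (theta t) (Rf (theta t)) != 0 ->
  is_derive (theta t) 1 Rf (eps * slope N h eps (theta t) (Rf (theta t))) ->
  is_derive t 1 theta (ang_speed N h eps (theta t) (Rf (theta t))) ->
  has_velocity (fun s => polar_curve Rf (theta s)) t (F (polar_curve Rf (theta t))).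
Proof.
move=> HF R0 w0 dR dth; rewrite /polar_curve HF//.
have dRth := @is_derive1_comp R Rf theta t _ _ dR dth.
have E : eps * slope N h eps (theta t) (Rf (theta t)) *
    ang_speed N h eps (theta t) (Rf (theta t)) =
    eps * slope0 N h (theta t) (Rf (theta t)) by rewrite /slope -mulrA divfK.
rewrite E in dRth.
have cs := cos2Dsin2 (theta t).
split => /=.
- apply: is_derive_eq (is_deriveM dRth (is_derive_sin_comp dth)) _.
  rewrite /GRing.scale /= /slope0 /ang_speed; ring.
- apply: is_derive_eq (is_deriveM dRth (is_derive_cos_comp dth)) _.
  rewrite /GRing.scale /= /slope0 /ang_speed.
  set v := polar_pert _ _ _ _; rewrite -[X in _ - eps * X]mulr1 -{2}cs; ring.
Qed.

(** With the radius a known function of the angle, time as a function of the angle is a plain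
    antiderivative of the inverse speed. Its inverse function is the angle. *)
Lemma angle_of_time (rho : R) : 0 < rho -> exists2 e0, 0 < e0 &
  forall eps Rf phi0 t0, `|eps| < e0 -> continuous Rf -> exists theta tm,
  [/\ theta t0 = phi0, cancel theta tm, cancel tm theta,
    forall t : R, is_derive t 1 theta (ang_speed N h eps (theta t) (clamp rho (Rf (theta t)))) &
    forall phi : R, is_derive phi 1 tm (ang_speed N h eps phi (clamp rho (Rf phi)))^-1 ].
Proof.
move=> rho0; have [C [e0 [C0 e00 est]]] := slope_estimates N bounded_h rho.
exists e0 => // eps Rf phi0 t0 epse cR.
pose w phi := ang_speed N h eps phi (clamp rho (Rf phi)).
have cl x : 0 <= clamp rho x <= rho by apply: clamp_itv; exact: ltW.
have w12 phi : 1 / 2 <= w phi <= 2.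
  by have [] := est eps phi _ _ _ epse (cl (Rf phi)) (cl 0) (cl 0).
have w0 phi : w phi != 0 by apply: lt0r_neq0; have := w12 phi; lra.
have cw : continuous w.
  apply: (@ang_speed_continuous R N h cont_h eps (fun phi => clamp rho (Rf phi))) => t.
  apply: (@continuous_comp _ _ _ Rf (clamp rho)); first exact: cR.
  by apply: clamp_continuous; exact: ltW.
have [H H0 dH] := antiderivative phi0 (fun phi => cvgV (w0 phi) (cw phi)).
have [k [kK Kk dk]] : exists k, [/\ cancel (fun phi => t0 + H phi) k,
    cancel k (fun phi => t0 + H phi) &
    forall y : R, is_derive y 1 k ((w (k y))^-1)^-1].
  apply: (@derive_ge_inverse R _ (fun phi => (w phi)^-1) (1 / 2)) => [|t|t].
  - lra.
  - by rewrite -[(w t)^-1]add0r; exact: is_deriveD.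
  - have := w12 t => /andP[? ?]; rewrite -[leLHS]invrK lef_pV2 ?posrE ?invr_gt0; lra.
exists k, (fun phi => t0 + H phi); split => //.
- by rewrite -[LHS]/(k t0) -[in LHS](addr0 t0) -H0 kK.
- by move=> t; have := dk t; rewrite invrK.
- by move=> phi; rewrite -[_^-1]add0r; exact: is_deriveD.
Qed.

(** It is used with [F] equal to X or to Y: [crosses_at] wants an integral curve of each of them
    through the crossing point, continued beyond the switching line. The starting angle is 0 or pi
    according to the sign of y. *)
Lemma local_polar_solution (rho : R) : 0 < rho -> exists2 e0, 0 < e0 &
  forall eps F t0 (p : R * R), `|eps| < e0 -> polar_field eps F ->
  p.1 = 0 -> p.2 != 0 -> `|p.2| < rho ->
  exists d z, [/\ 0 < d, z t0 = p & integral_curve_on F (ball t0 d) z].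
Proof.
move=> rho0; have [C [e1 [C0 e10 est]]] := slope_estimates N bounded_h rho.
have [e2 e20 clsol] := clamped_solution N bounded_h cont_h rho0.
have [e3 e30 ang] := angle_of_time rho0.
exists (Num.min e1 (Num.min e2 e3)); first by rewrite !lt_min e10 e20.
move=> eps F t0 p; rewrite !lt_min => /and3P[l1 l2 l3] HF p1 p2 p2rho.
have [phi0 Hphi0] : exists phi0, p = (`|p.2| * sin phi0, `|p.2| * cos phi0).
  have [p2p|p2n|p20] := ltgtP 0 p.2; last by rewrite -p20 eqxx in p2.
  - exists 0; rewrite sin0 cos0 mulr0 mulr1 gtr0_norm//.
    by rewrite {1}[p]surjective_pairing p1.
  - exists pi; rewrite sinpi cospi mulr0 mulrN1 ltr0_norm// opprK.
    by rewrite {1}[p]surjective_pairing p1.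
have [Rf R0 dR] := clsol eps phi0 `|p.2| l2.
have cR := is_derive_continuous dR.
have [theta [tm [th0 _ _ dth _]]] := ang eps Rf phi0 t0 l3 cR.
have cRth : {for t0, continuous (Rf \o theta)}.
  by apply: continuous_comp; [exact: (is_derive_continuous dth)|exact: cR].
have Rt0 : (Rf \o theta) t0 = `|p.2| by rewrite /= th0.
have m0 : 0 < Num.min `|p.2| (rho - `|p.2|) by rewrite lt_min normr_gt0 p2 subr_gt0.
have /cvgrPdist_lt /(_ _ m0) /nbhs_ballP [d /= d0 Hd] := cRth.
exists d, (fun s => polar_curve Rf (theta s)); split => //.
  by rewrite /polar_curve th0 R0 -Hphi0.
move=> s /Hd /=; rewrite th0 R0 lt_min => /andP[].
rewrite !ltr_norml => /andP[? ?] /andP[? ?].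
have Rs : 0 <= Rf (theta s) <= rho by apply/andP; split; lra.
have := dth s; have := dR (theta s); rewrite clamp_id// => dRs dths.
apply: polar_has_velocity => //; first lra.
have [w _ _ _ _] := est eps (theta s) _ _ _ l1 Rs Rs Rs.
by apply: lt0r_neq0; lra.
Qed.

End PolarToPlanar.

(** * Trajectories as integral curves of the continuous field *)

Section Trajectories.
Variables (R : realType) (f : {poly R}) (g : {poly {poly R}}).
Hypothesis g0 : forall y, g.[0%:P].[y] = 0.
Implicit Types (eps t s : R) (c p q : R -> R * R) (F : R * R -> R * R).

(* On x = 0 the sign is 0, which is harmless since g vanishes there: the two
   fields agree on the switching line and this field is continuous. *)
Definition planar_field eps (p : R * R) := field_of f g eps (Num.sg p.1) p.

Lemma field_of_cross eps sigma sigma' (p : R * R) : p.1 = 0 ->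
  field_of f g eps sigma p = field_of f g eps sigma' p.
Proof. by move=> p0; rewrite /field_of p0 g0 !mulr0. Qed.

Lemma has_velocity_glue c p q t v (d : R) : 0 < d ->
  has_velocity p t v -> has_velocity q t v ->
  (forall s, t <= s < t + d -> c s = q s) -> (forall s, t - d < s <= t -> c s = p s) ->
  has_velocity c t v.
Proof.
move=> d0 [p1 p2] [q1 q2] cq cp; split.
- by apply: (is_derive_glue d0 q1 p1) => s; [move=> /cq ->|move=> /cp ->].
- by apply: (is_derive_glue d0 q2 p2) => s; [move=> /cq ->|move=> /cp ->].
Qed.

Lemma has_velocity_near c p t v : (\forall s \near t, c s = p s) ->
  has_velocity p t v -> has_velocity c t v.
Proof.
move=> cp [p1 p2]; split.
- by apply: near_eq_is_derive p1; near=> s; rewrite (near cp s).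
- by apply: near_eq_is_derive p2; near=> s; rewrite (near cp s).
Unshelve. all: by end_near. Qed.

Lemma glue_integral_curve F p q t d : 0 < d -> p t = q t ->
  (forall s, t - d < s <= t -> has_velocity p s (F (p s))) ->
  (forall s, t <= s < t + d -> has_velocity q s (F (q s))) ->
  integral_curve_on F (ball t d) (fun s => if s < t then p s else q s).
Proof.
move=> d0 pq Hp Hq s; rewrite /ball /= ltr_distlC => /andP[s1 s2].
have [st|ts|st] := ltgtP s t.
- apply: (@has_velocity_near _ p); last by apply: Hp; rewrite s1 ltW.
  by near=> x; rewrite ifT//; near: x; exact: lt_nbhsl.
- apply: (@has_velocity_near _ q); last by apply: Hq; rewrite s2 ltW.
  by near=> x; rewrite ifF//; apply/negbTE; rewrite -leNgt ltW//; near: x; exact: lt_nbhsr.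
- rewrite st; apply: (@has_velocity_glue _ p q _ _ d d0).
  + by rewrite -pq; apply: Hp; rewrite lexx; lra.
  + by apply: Hq; rewrite lexx; lra.
  + by move=> x /andP[tx _]; rewrite ltNge tx.
  + by move=> x /andP[_]; case: ltgtP => // ->; rewrite pq.
Unshelve. all: by end_near. Qed.

(** At a crossing the two concatenated pieces have the same velocity, because the two fields agree
    on the switching line; the concatenation is therefore differentiable there. *)
Lemma trajectory_velocity eps c : trajectory f g eps c ->
  forall t, has_velocity c t (planar_field eps (c t)).
Proof.
move=> tr t; have [Hn Hc] := tr t; rewrite /planar_field.
have [c0|/Hn//] := eqVneq (c t).1 0.
have [c20 [d [phi [psi [d0 iphi ipsi cphi cpsi]]]]] := Hc c0.
have tphi : c t = phi t by apply: cphi; rewrite lexx; lra.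
have tpsi : c t = psi t by apply: cpsi; rewrite lexx; lra.
apply: (@has_velocity_glue c psi phi t _ d d0) => //.
- rewrite (field_of_cross _ _ (- Num.sg (c t).2) c0) {2}tpsi; apply: ipsi.
  exact: ballxx.
- rewrite (field_of_cross _ _ (Num.sg (c t).2) c0) {2}tphi; apply: iphi.
  exact: ballxx.
Qed.

Lemma sg_eq (x y : R) : 0 < x * y -> Num.sg x = Num.sg y.
Proof.
have [x0|x0|<-] := ltgtP 0 x; last by rewrite mul0r ltxx.
- by rewrite pmulr_rgt0// => y0; rewrite !gtr0_sg.
- by rewrite nmulr_rgt0// => y0; rewrite !ltr0_sg.
Qed.

(** Since x' = y and y keeps its sign near t, the mean value theorem shows that x passes from the
    sign opposite to that of y to the sign of y. *)
Lemma crossing_sign eps c t : (forall t, has_velocity c t (planar_field eps (c t))) ->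
  (c t).1 = 0 -> (c t).2 != 0 -> exists2 d, 0 < d &
  (forall s, t < s < t + d -> Num.sg (c s).1 = Num.sg (c t).2) /\
  (forall s, t - d < s < t -> Num.sg (c s).1 = - Num.sg (c t).2).
Proof.
move=> vc c1 c2.
have d1 s : is_derive s 1 (fun s => (c s).1) (c s).2 by have [] := vc s.
have cc2 : {for t, continuous (fun s => (c s).2)}.
  by have [_ d2] := vc t; exact: is_derive_continuous_at d2.
have n2 : 0 < `|(c t).2| by rewrite normr_gt0.
have /cvgrPdist_lt /(_ _ n2) /nbhs_ballP [d /= d0 Hd] := cc2.
have Hs s : t - d < s < t + d -> 0 < (c s).2 * (c t).2.
  move=> Hs; apply: same_sign_near; rewrite distrC; apply: Hd.
  by rewrite /ball /= ltr_distlC.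
have cont1 := is_derive_continuous d1.
exists d => //; split => s /andP[s1 s2].
- have [x xt] := @MVT R _ _ t s s1 (fun x _ => d1 x) (continuous_subspaceT cont1).
  rewrite c1 subr0 => E; apply: sg_eq; rewrite E.
  move: xt; rewrite in_itv/= => /andP[x1 x2].
  rewrite mulrAC mulr_gt0 ?subr_gt0// Hs//; apply/andP; split; lra.
- have [x xt] := @MVT R _ _ s t s2 (fun x _ => d1 x) (continuous_subspaceT cont1).
  rewrite c1 sub0r -sgrN => E; apply: sg_eq; rewrite mulrN -mulNr E.
  move: xt; rewrite in_itv/= => /andP[x1 x2].
  rewrite mulrAC mulr_gt0 ?subr_gt0// Hs//; apply/andP; split; lra.
Qed.

Lemma velocity_trajectory eps c :
  (forall t, has_velocity c t (planar_field eps (c t))) ->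
  (forall t, (c t).1 = 0 -> (c t).2 != 0) ->
  (forall sigma t, `|sigma| = 1 -> (c t).1 = 0 -> exists d z, [/\ 0 < d, z t = c t &
    integral_curve_on (field_of f g eps sigma) (ball t d) z]) ->
  trajectory f g eps c.
Proof.
move=> vc c2 loc t; split => [_|c1]; first exact: vc.
have c20 := c2 t c1; split => //.
have [d0 d00 [sgp sgn]] := crossing_sign vc c1 c20.
have ns : `|Num.sg (c t).2| = 1 by rewrite normr_sg c20.
have [dp [zp [dp0 zpt izp]]] := loc _ t ns c1.
have [|dm [zm [dm0 zmt izm]]] := loc (- Num.sg (c t).2) t _ c1; first by rewrite normrN.
pose d := Num.min d0 (Num.min dp dm).
have [dd0 ddp ddm] : [/\ d <= d0, d <= dp & d <= dm].
  by rewrite /d !ge_min !lexx !orbT.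
have dpos : 0 < d by rewrite /d !lt_min d00 dp0.
(* Each half of c is continued across the switching line by a local solution of
   the corresponding smooth field. *)
exists d, (fun s => if s < t then zp s else c s), (fun s => if s < t then c s else zm s).
split => //.
- apply: glue_integral_curve => // s /andP[s1 s2].
  + by apply: izp; rewrite /ball /= ltr_distlC; apply/andP; split; lra.
  + have := vc s; rewrite /planar_field.
    move: s1; rewrite le_eqVlt => /predU1P[<-|ts].
      by rewrite (field_of_cross _ _ (Num.sg (c t).2) c1).
    by rewrite sgp// ts; lra.
- apply: glue_integral_curve => // s /andP[s1 s2].
  + have := vc s; rewrite /planar_field.
    move: s2; rewrite le_eqVlt => /predU1P[->|ts].
      by rewrite (field_of_cross _ _ (- Num.sg (c t).2) c1).
    by rewrite sgn// ts andbT; lra.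
  + by apply: izm; rewrite /ball /= ltr_distlC; apply/andP; split; lra.
- by move=> s /andP[ts _]; rewrite ltNge ts.
- by move=> s /andP[_]; case: ltgtP => // ->; rewrite zmt.
Qed.

End Trajectories.

Section Angles.
Variable R : realType.
Notation tau := ((pi : R) *+ 2).
Implicit Types x y a b : R.

Lemma polar_angle x y : x ^+ 2 + y ^+ 2 = 1 -> exists a, sin a = x /\ cos a = y.
Proof.
move=> xy.
have y1 : -1 <= y <= 1.
  by rewrite -ler_norml -(@expr_le1 _ 2)// real_normK ?num_real//; have := sqr_ge0 x; lra.
have sx : sin (acos y) = `|x|.
  by rewrite sin_acos// -sqrtr_sqr; congr Num.sqrt; lra.
have cy : cos (acos y) = y by rewrite acosK.
have [x0|x0] := leP 0 x.
- by exists (acos y); rewrite sx ger0_norm.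
- by exists (- acos y); rewrite sinN cosN sx ltr0_norm// opprK.
Qed.

(** Here cos b = 1. The remainder y of b modulo a full turn is 0, since cos y = 1 - 2 sin(y/2)^2 is
    less than 1 for 0 < y < 2 pi. *)
Lemma full_turns a b : sin (a + b) = sin a -> cos (a + b) = cos a -> 0 < b ->
  exists2 k, (0 < k)%N & b = tau *+ k.
Proof.
move=> Es Ec b0.
have cb : cos b = 1.
  have -> : b = (a + b) - a by ring.
  by rewrite cosB Es Ec -!expr2 cos2Dsin2.
have [z [y [/andP[y0 yt] bE]]] := reduce_mod b (tau_gt0 R).
have cy : cos y = 1 by rewrite -cb bE (periodicz (@cosD2pi R)).
have y00 : y = 0.
  apply/eqP; rewrite eq_le y0 andbT leNgt; apply/negP => yp.
  have sy : 0 < sin (y / 2).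
    by apply: sin_gt0_pi; move: yt; rewrite mulr2n => yt; apply/andP; split; lra.
  have : cos ((y / 2) *+ 2) = 1 by rewrite -mulr_natr divfK.
  rewrite cos_mulr2n cos2sin2 mulr2n => H.
  have := exprn_gt0 2 sy; lra.
move: bE; rewrite y00 add0r; case: z => n bE.
- exists n => //; rewrite lt0n; apply/eqP => n0; move: b0; rewrite bE n0 mulr0z.
  by rewrite ltxx.
- move: b0; rewrite bE NegzE mulrNz oppr_gt0 ltNge => /negP[].
  by rewrite mulrn_wge0// ltW// tau_gt0.
Qed.

End Angles.

(** * Periodic orbits and periodic solutions of the radial equation *)

Section Orbits.
Variables (R : realType) (f : {poly R}) (g : {poly {poly R}}) (N : nat).
(** [h] describes the continuous planar field; [hs 1] and [hs (-1)] describe X and Y, and serve to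
    build the local solutions at crossings. *)
Variables (h : nat -> R -> R) (hs : R -> nat -> R -> R).
Implicit Types (eps phi r t s eta : R) (Rf theta : R -> R).
Notation tau := ((pi : R) *+ 2).
Hypothesis g0 : forall y, g.[0%:P].[y] = 0.
Hypothesis bounded_h : exists M, forall k phi, `|h k phi| <= M.
Hypothesis cont_h : forall k, continuous (h k).
Hypothesis per_h : forall k, periodic (h k) tau.
Hypothesis bounded_hs : forall sigma, `|sigma| = 1 ->
  exists M, forall k phi, `|hs sigma k phi| <= M.
Hypothesis cont_hs : forall sigma k, `|sigma| = 1 -> continuous (hs sigma k).
Hypothesis field_h : forall eps, polar_field N h eps (planar_field f g eps).
Hypothesis field_hs : forall eps sigma, `|sigma| = 1 ->
  polar_field N (hs sigma) eps (field_of f g eps sigma).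
Hypothesis cont_pert : forall c1 c2 : R -> R, continuous c1 -> continuous c2 ->
  continuous (fun t => f.[c1 t] * c2 t + Num.sg (c1 t) * g.[(c1 t)%:P].[c2 t]).

Lemma slope_solution_orbit r : 0 < r -> exists2 e0, 0 < e0 & forall eps Rf,
  `|eps| < e0 -> slope_solution N h eps Rf -> periodic Rf tau ->
  (forall phi, 0 < Rf phi < 2 * r) -> periodic_orbit f g eps (range (polar_curve Rf)).
Proof.
move=> r0; have r20 : 0 < 2 * r by lra.
have [C [e1 [C0 e10 est]]] := slope_estimates N bounded_h (2 * r).
have [e2 e20 ang] := angle_of_time N bounded_h cont_h r20.
have [e3 e30 loc1] := local_polar_solution N (bounded_hs (normr1 R))
  (fun k => @cont_hs 1 k (normr1 R)) r20.
have n1 : `|-1 : R| = 1 by rewrite normrN normr1.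
have [e4 e40 loc2] := local_polar_solution N (bounded_hs n1)
  (fun k => @cont_hs (-1) k n1) r20.
exists (Num.min (Num.min e1 e2) (Num.min e3 e4)); first by rewrite !lt_min e10 e20 e30.
move=> eps Rf; rewrite !lt_min => /andP[/andP[l1 l2] /andP[l3 l4]] sol per Rr.
have cR := is_derive_continuous sol.
have Rr' phi : 0 <= Rf phi <= 2 * r by have := Rr phi; lra.
have w12 phi : 1 / 2 <= ang_speed N h eps phi (Rf phi) <= 2.
  by have [] := est eps phi _ _ _ l1 (Rr' phi) (Rr' phi) (Rr' phi).
have w0 phi : ang_speed N h eps phi (Rf phi) != 0.
  by apply: lt0r_neq0; have := w12 phi; lra.
have [theta [tm [th0 thK tmK dth dtm]]] := ang eps Rf 0 0 l2 cR.
have {}dth t : is_derive t 1 theta (ang_speed N h eps (theta t) (Rf (theta t))).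
  by have := dth t; rewrite clamp_id.
have {}dtm phi : is_derive phi 1 tm (ang_speed N h eps phi (Rf phi))^-1.
  by have := dtm phi; rewrite clamp_id.
pose c t := polar_curve Rf (theta t); pose T := tm tau.
have tm0 : tm 0 = 0 by rewrite -{1}th0 thK.
have T0 : 0 < T.
  have t0 := tau_gt0 R.
  have [phi _] := @MVT R tm _ 0 tau t0 (fun x _ => dtm x)
    (continuous_subspaceT (is_derive_continuous dtm)).
  rewrite tm0 !subr0 /T => ->; rewrite mulr_gt0// invr_gt0.
  by have := w12 phi; lra.
(* The inverse speed is periodic in the angle, so every turn takes the same time T. *)
have tmT phi : tm (phi + tau) = tm phi + T.
  have D0 (s : R) : is_derive s 1 (fun s => tm (s + tau) - tm s) 0.
    rewrite -(subrr (ang_speed N h eps s (Rf s))^-1).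
    apply: is_deriveB; rewrite -ang_speed_periodic// -(per s).
    exact: is_derive_shiftr.
  by have := is_derive_0_is_cst phi 0 D0; rewrite /= add0r tm0 subr0 -/T; lra.
have thT t : theta (t + T) = theta t + tau.
  by apply: (can_inj tmK); rewrite thK tmT thK.
have pcper phi : polar_curve Rf (phi + tau) = polar_curve Rf phi.
  by rewrite /polar_curve per sinD2pi cosD2pi.
exists c, T; split => //.
- apply: velocity_trajectory => // [t|t|sigma t sg1 c1].
  + by have /andP[Rp _] := Rr (theta t); exact: (polar_has_velocity (field_h eps) Rp (w0 _) (sol _) (dth t)).
  + rewrite /c /polar_curve /= => /eqP; have /andP[Rp _] := Rr (theta t).
    rewrite mulf_eq0 (gt_eqF Rp)/= => /eqP s0.
    rewrite mulf_neq0 ?(gt_eqF Rp)//; apply/eqP => c0.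
    have := cos2Dsin2 (theta t); rewrite s0 c0 expr0n/= addr0 => /eqP.
    by rewrite eq_sym oner_eq0.
  + have c2 : (c t).2 != 0.
      move: c1; rewrite /c /polar_curve /= => /eqP; have /andP[Rp _] := Rr (theta t).
      rewrite mulf_eq0 (gt_eqF Rp)/= => /eqP s0.
      rewrite mulf_neq0 ?(gt_eqF Rp)//; apply/eqP => c0.
      have := cos2Dsin2 (theta t); rewrite s0 c0 expr0n/= addr0 => /eqP.
      by rewrite eq_sym oner_eq0.
    have c2r : `|(c t).2| < 2 * r.
      rewrite /c /polar_curve /= normrM; have /andP[Rp Rq] := Rr (theta t).
      by rewrite (gtr0_norm Rp) (le_lt_trans _ Rq)// ler_piMr ?cos_max// ltW.
    have [s1|s1] : sigma = 1 \/ sigma = -1.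
      have [s0|s0|s0] := ltgtP 0 sigma.
      - by left; rewrite -sg1 gtr0_norm.
      - by right; rewrite -sg1 ltr0_norm// opprK.
      - by move: sg1; rewrite -s0 normr0 => /esym/eqP; rewrite oner_eq0.
    * rewrite s1; apply: (loc1 eps _ t (c t) l3) => //.
      by apply: field_hs; exact: normr1.
    * by rewrite s1; apply: (loc2 eps _ t (c t) l4) => //; exact: field_hs.
- by move=> t; rewrite /c thT.
(* The points at angles 0 and pi have y of opposite signs, so the curve is not constant. *)
- exists (tm pi) => /(congr1 snd); rewrite /c tmK th0 /polar_curve /= cospi cos0.
  by have := Rr pi; have := Rr 0; lra.
- apply/seteqP; split => _ [x _ <-].
  + by exists (tm x) => //; rewrite /c tmK.
  + by exists (theta x).
Qed.

(** The angle along an arbitrary orbit is lifted by integrating its speed [om]. That speed is at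
    least 1/2, so the lifted angle is invertible and the radius becomes a function of the angle. *)
Lemma orbit_slope_solution r : 0 < r -> exists2 e0, 0 < e0 & forall eps eta G,
  `|eps| < e0 -> 0 < eta <= r -> periodic_orbit f g eps G ->
  (forall p, G p -> `|p.1 ^+ 2 + p.2 ^+ 2 - r ^+ 2| < eta * r) ->
  exists Rf k, [/\ slope_solution N h eps Rf, forall phi, `|Rf phi - r| < eta,
    (0 < k)%N, periodic Rf (tau *+ k) & G = range (polar_curve Rf)].
Proof.
move=> r0; have [C [e1 [C0 e10 est]]] := slope_estimates N bounded_h (2 * r).
exists e1 => // eps eta G epse /andP[eta0 etar] [c [T [T0 tr cT _ GE]]] Gr.
have vel := trajectory_velocity g0 tr.
pose x t := (c t).1; pose y t := (c t).2.
pose V t := f.[x t] * y t + Num.sg (x t) * g.[(x t)%:P].[y t].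
have dx t : is_derive t 1 x (y t) by have [] := vel t.
have dy t : is_derive t 1 y (- x t - eps * V t) by have [] := vel t.
have cx := is_derive_continuous dx; have cy := is_derive_continuous dy.
have cV : continuous V by exact: cont_pert.
pose q t := x t ^+ 2 + y t ^+ 2; pose rho t := Num.sqrt (q t).
have near_q t : `|q t - r ^+ 2| < eta * r.
  by apply: Gr; rewrite GE; exists t.
have er : eta * r <= r ^+ 2 by rewrite expr2 ler_pM2r.
have q0 t : 0 < q t.
  by have := near_q t; rewrite ltr_norml => /andP[]; lra.
have rho0 t : 0 < rho t by rewrite sqrtr_gt0.
have rho2 t : rho t ^+ 2 = q t by rewrite sqr_sqrtr// ltW.
(* The factor r in the hypothesis [eta * r] is a lower bound for rho + r in rho^2 - r^2 = (rho -
   r)(rho + r). *)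
have rhor t : `|rho t - r| < eta.
  have := near_q t; rewrite -rho2 subr_sqr normrM.
  have H : 0 < rho t + r by rewrite addr_gt0.
  rewrite (gtr0_norm H) => Hlt.
  rewrite -(ltr_pM2r r0); apply: le_lt_trans Hlt; rewrite ler_wpM2l// lerDr ltW//.
have rhole t : 0 <= rho t <= 2 * r.
  by have := rhor t; rewrite ltr_norml => /andP[? ?]; have := rho0 t; lra.
have rhon t : rho t != 0 by rewrite gt_eqF.
have dq t : is_derive t 1 q (- (2 * (eps * V t * y t))).
  have xx := is_deriveM (dx t) (dx t); have yy := is_deriveM (dy t) (dy t).
  have -> : q = x * x + y * y by apply/funext => s; rewrite /q !expr2 fctE.
  by apply: is_derive_eq (is_deriveD xx yy) _; rewrite /GRing.scale /=; ring.
have drho t : is_derive t 1 rho (- (eps * V t * y t / rho t)).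
  have := @is_derive1_comp R Num.sqrt q t _ _ (is_derive1_sqrt (q0 t)) (dq t).
  move=> H; apply: is_derive_eq H _; rewrite -/(rho t); field; exact: rhon.
pose om t := 1 + eps * (x t * V t / q t).
have com : continuous om.
  move=> t; apply: cvgD; first exact: cvg_cst.
  apply: cvgM; first exact: cvg_cst.
  apply: cvgM; first by apply: cvgM; [exact: cx|exact: cV].
  apply: cvgV; first by rewrite gt_eqF.
  exact: (is_derive_continuous dq).
have [th0 [s0 c0]] : exists a, sin a = x 0 / rho 0 /\ cos a = y 0 / rho 0.
  apply: polar_angle; rewrite !expr_div_n -mulrDl -/(q 0) -rho2 divff//.
  by rewrite expf_neq0.
have [H H0 dH] := antiderivative 0 com.
pose theta t := th0 + H t.
have dth t : is_derive t 1 theta (om t) by rewrite -[om t]add0r; exact: is_deriveD.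
have drV t : is_derive t 1 (fun s => (rho s)^-1) (eps * V t * y t / (rho t ^+ 3)).
  have := is_deriveV (rhon t) (drho t).
  move=> K; apply: is_derive_eq K _; rewrite /GRing.scale /=; field; exact: rhon.
have rho_q t : x t ^+ 2 = rho t ^+ 2 - y t ^+ 2 by rewrite rho2 /q; ring.
have du t : is_derive t 1 (fun s => x s * (rho s)^-1) (om t * (y t / rho t)).
  apply: is_derive_eq (is_deriveM (dx t) (drV t)) _; rewrite /GRing.scale /= /om -rho2.
  by field; exact: rhon.
have dv t : is_derive t 1 (fun s => y s * (rho s)^-1) (- (om t * (x t / rho t))).
  apply: is_derive_eq (is_deriveM (dy t) (drV t)) _; rewrite /GRing.scale /= /om -rho2.
  have E : y t ^+ 2 = rho t ^+ 2 - x t ^+ 2 by rewrite rho_q; ring.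
  have -> : y t * (eps * V t * y t / rho t ^+ 3) = eps * V t * (y t ^+ 2) / rho t ^+ 3.
    by ring.
  by rewrite E; field; exact: rhon.
have ds t := is_derive_sin_comp (dth t); have dc t := is_derive_cos_comp (dth t).
have th00 : theta 0 = th0 by rewrite /theta H0 addr0.
(* The unit vector (x, y) / rho rotates with speed om, hence theta is its angle. *)
have A0 t : x t / rho t * cos (theta t) - y t / rho t * sin (theta t) = 0.
  have D0 (s : R) : is_derive s 1 (fun s => x s / rho s * cos (theta s) -
      y s / rho s * sin (theta s)) 0.
    have K := is_deriveB (is_deriveM (du s) (dc s)) (is_deriveM (dv s) (ds s)).
    by apply: is_derive_eq K _; rewrite /GRing.scale /=; ring.
  rewrite (is_derive_0_is_cst t 0 D0) th00 -s0 -c0; ring.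
have B1 t : x t / rho t * sin (theta t) + y t / rho t * cos (theta t) = 1.
  have D0 (s : R) : is_derive s 1 (fun s => x s / rho s * sin (theta s) +
      y s / rho s * cos (theta s)) 0.
    have K := is_deriveD (is_deriveM (du s) (ds s)) (is_deriveM (dv s) (dc s)).
    by apply: is_derive_eq K _; rewrite /GRing.scale /=; ring.
  by rewrite (is_derive_0_is_cst t 0 D0) th00 -s0 -c0 -!expr2 addrC cos2Dsin2.
have xs t : x t = rho t * sin (theta t).
  have : x t / rho t = sin (theta t).
    have -> : x t / rho t = (x t / rho t * cos (theta t) - y t / rho t * sin (theta t)) *
        cos (theta t) + (x t / rho t * sin (theta t) + y t / rho t * cos (theta t)) *
        sin (theta t).
      have := cos2Dsin2 (theta t) => cs.
      by rewrite -[LHS]mulr1 -cs; ring.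
    by rewrite A0 B1 mul0r add0r mul1r.
  by move=> <-; rewrite mulrC divfK.
have yc t : y t = rho t * cos (theta t).
  have : y t / rho t = cos (theta t).
    have -> : y t / rho t = (x t / rho t * sin (theta t) + y t / rho t * cos (theta t)) *
        cos (theta t) - (x t / rho t * cos (theta t) - y t / rho t * sin (theta t)) *
        sin (theta t).
      have := cos2Dsin2 (theta t) => cs.
      by rewrite -[LHS]mulr1 -cs; ring.
    by rewrite A0 B1 mul0r subr0 mul1r.
  by move=> <-; rewrite mulrC divfK.
(* The factor eps is kept on both sides: eps may be 0 here, and the field determines only
   [eps * V t]. *)
have Vv t : eps * V t = eps * (rho t * polar_pert N h (theta t) (rho t)).
  have := congr1 snd (field_h eps (theta t) (rho0 t)).
  by rewrite /planar_field /field_of /= -xs -yc -/(V t) => /(addrI _) /oppr_inj.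
have omE t : om t = ang_speed N h eps (theta t) (rho t).
  rewrite /om /ang_speed -rho2.
  have -> : eps * (x t * V t / rho t ^+ 2) = eps * V t * (x t / rho t ^+ 2) by ring.
  by rewrite Vv {1}xs; field; exact: rhon.
have drho' t : is_derive t 1 rho (eps * slope0 N h (theta t) (rho t)).
  apply: is_derive_eq (drho t) _; rewrite Vv {1}yc /slope0; field; exact: rhon.
have w12 t : 1 / 2 <= om t <= 2.
  by rewrite omE; have [] := est eps (theta t) _ _ _ epse (rhole t) (rhole t) (rhole t).
have half0 : 0 < 1 / 2 :> R by lra.
have [tm [thK tmK dtm]] := derive_ge_inverse half0 dth (fun t => (andP (w12 t)).1).
pose Rf phi := rho (tm phi).
have sol : slope_solution N h eps Rf.
  move=> phi; have := @is_derive1_comp R rho tm phi _ _ (drho' (tm phi)) (dtm phi).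
  move=> K; apply: is_derive_eq K _; rewrite tmK omE tmK /slope; ring.
have xT t : x (t + T) = x t by rewrite /x cT.
have yT t : y (t + T) = y t by rewrite /y cT.
have rT t : rho (t + T) = rho t by rewrite /rho /q xT yT.
have thT t : theta (t + T) = theta t + (theta T - theta 0).
  have D0 (s : R) : is_derive s 1 (fun s => theta (s + T) - theta s) 0.
    rewrite -(subrr (om s)).
    have oT : om (s + T) = om s by rewrite /om /q /V xT yT.
    by apply: is_deriveB; rewrite -oT; exact: is_derive_shiftr.
  by have := is_derive_0_is_cst t 0 D0; rewrite /= add0r; lra.
have Dpos : 0 < theta T - theta 0.
  have [s _ ->] := @MVT R theta _ 0 T T0 (fun x _ => dth x)
    (continuous_subspaceT (is_derive_continuous dth)).
  by rewrite subr0 mulr_gt0//; have := w12 s; lra.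
have [xT0 yT0 rT0] : [/\ x T = x 0, y T = y 0 & rho T = rho 0].
  by rewrite -[T]add0r xT yT rT.
have D0 : theta 0 + (theta T - theta 0) = theta T by rewrite addrC subrK.
have sT : sin (theta 0 + (theta T - theta 0)) = sin (theta 0).
  by apply: (mulfI (rhon 0)); rewrite D0 -xs -xT0 xs rT0.
have cosT : cos (theta 0 + (theta T - theta 0)) = cos (theta 0).
  by apply: (mulfI (rhon 0)); rewrite D0 -yc -yT0 yc rT0.
(* The orbit may wind around several times before closing, so k need not be 1. *)
have [k k0 kE] := full_turns sT cosT Dpos.
exists Rf, k; split => //.
- by move=> phi; exact: rhor.
- move=> phi; rewrite /Rf; have -> : phi + tau *+ k = theta (tm phi + T).
    by rewrite thT tmK -kE.
  by rewrite thK rT.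
- rewrite GE; apply/seteqP; split => _ [s _ <-].
  + exists (theta s) => //; rewrite /polar_curve /Rf thK -xs -yc.
    by rewrite -surjective_pairing.
  + exists (tm s) => //; rewrite /polar_curve /Rf; have := xs (tm s); have := yc (tm s).
    by rewrite tmK => <- <-; rewrite -surjective_pairing.
Qed.

End Orbits.

(** * Limit cycles near simple zeros of the averaged function *)

Section Annuli.
Variable R : realType.
Implicit Types (r eta : R) (G : set (R * R)).

Definition annulus r eta : set (R * R) :=
  [set p | `|p.1 ^+ 2 + p.2 ^+ 2 - r ^+ 2| < eta].

Lemma common_positive_bound (I : finType) (Q : I -> R -> Prop) :
  (forall i, exists2 e, 0 < e & Q i e) ->
  (forall i e e', 0 < e' <= e -> Q i e -> Q i e') ->
  exists2 e, 0 < e & forall i, Q i e.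
Proof.
move=> ex mono.
have /choice[e eP] : forall i, exists e, 0 < e /\ Q i e.
  by move=> i; have [e] := ex i; exists e.
have b0 : 0 < \big[Num.min/1]_i e i.
  by apply/bigmin_gtP; split => // i _; have [] := eP i.
exists (\big[Num.min/1]_i e i) => // i; apply: (mono i (e i)); last by have [] := eP i.
by rewrite b0 bigmin_le.
Qed.

Lemma open_annulus r eta : open (annulus r eta).
Proof.
have -> : annulus r eta =
    (fun p : R * R => p.1 ^+ 2 + p.2 ^+ 2 - r ^+ 2) @^-1` (ball (0 : R) eta).
  by apply/seteqP; split => p; rewrite /annulus /ball /= sub0r normrN.
apply: open_comp; last exact: ball_open.
move=> p _; apply: cvgB; last exact: cvg_cst.
apply: cvgD; rewrite expr2.
  by apply: cvgM; exact: cvg_fst.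
by apply: cvgM; exact: cvg_snd.
Qed.

Lemma annulus_sub r eta eta' : eta' <= eta -> annulus r eta' `<=` annulus r eta.
Proof. by move=> le p /= /lt_le_trans; apply. Qed.

Lemma hausdorff_close_annulus r eta : 0 < r -> 0 < eta -> exists2 d, 0 < d &
  forall G, hausdorff_close d G (circle r) -> G `<=` annulus r eta.
Proof.
(* For coordinates with [|u - v| < 1] and [|v| <= r], u^2 - v^2 is at most [|u - v|] times 1 + 2r;
   each of the two coordinates may spend eta / 2. *)
move=> r0 eta0; exists (Num.min 1 (eta / (2 * (1 + 2 * r)))).
  by rewrite lt_min ltr01 divr_gt0// mulr_gt0//; lra.
move=> G [HG _] p Gp; have [b bc [/= b1 b2]] := HG p Gp.
move: b1 b2; rewrite /ball /= !lt_min => /andP[a1 a2] /andP[a3 a4].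
move: a2 a4; rewrite !ltr_pdivlMr ?mulr_gt0//; try lra; move=> a2 a4.
have bE : b.1 ^+ 2 + b.2 ^+ 2 = r ^+ 2 := bc.
have nb1 : `|b.1| <= r.
  by rewrite -ler_sqr ?nnegrE ?(ltW r0)// real_normK ?num_real// -bE lerDl sqr_ge0.
have nb2 : `|b.2| <= r.
  by rewrite -ler_sqr ?nnegrE ?(ltW r0)// real_normK ?num_real// -bE lerDr sqr_ge0.
have key (u v : R) : `|u - v| < 1 -> `|v| <= r ->
    `|u - v| * (2 * (1 + 2 * r)) < eta -> `|u ^+ 2 - v ^+ 2| < eta / 2.
  move=> uv1 vr uve; have -> : u ^+ 2 - v ^+ 2 = (u - v) * ((u - v) + 2 * v) by ring.
  rewrite normrM; apply: (@le_lt_trans _ _ (`|u - v| * (1 + 2 * r))); last lra.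
  rewrite ler_wpM2l// (le_trans (ler_normD _ _))// normrM ger0_norm//; lra.
have := key _ _ a1 nb1 a2; have := key _ _ a3 nb2 a4.
rewrite /annulus /= -bE.
have -> : p.1 ^+ 2 + p.2 ^+ 2 - (b.1 ^+ 2 + b.2 ^+ 2) =
  (p.1 ^+ 2 - b.1 ^+ 2) + (p.2 ^+ 2 - b.2 ^+ 2) by ring.
have := ler_normD (p.1 ^+ 2 - b.1 ^+ 2) (p.2 ^+ 2 - b.2 ^+ 2); lra.
Qed.

Lemma polar_curve_close r eta (Rf : R -> R) : 0 < r ->
  (forall phi, `|Rf phi - r| < eta) ->
  hausdorff_close eta (range (polar_curve Rf)) (circle r).
Proof.
move=> r0 Rr.
have cl phi : ball (polar_curve Rf phi) eta (r * sin phi, r * cos phi).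
  split; rewrite /ball /= -mulrBl normrM (le_lt_trans _ (Rr phi))//.
  - by rewrite ler_piMr// sin_max.
  - by rewrite ler_piMr// cos_max.
split.
- move=> _ [phi _ <-]; exists (r * sin phi, r * cos phi) => //.
  by rewrite /circle /= !exprMn -mulrDr addrC cos2Dsin2 mulr1.
- move=> b bc; have rn : r != 0 by rewrite gt_eqF.
  have bE : b.1 ^+ 2 + b.2 ^+ 2 = r ^+ 2 := bc.
  have [|phi [s c]] := @polar_angle R (b.1 / r) (b.2 / r).
    by rewrite !expr_div_n -mulrDl bE divff// expf_neq0.
  exists (polar_curve Rf phi); first by exists phi.
  apply: ball_sym.
  suff -> : b = (r * sin phi, r * cos phi) by exact: cl.
  by rewrite s c ![r * _]mulrC !divfK// -surjective_pairing.
Qed.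

End Annuli.

Section Bifurcation.
Variables (R : realType) (f : {poly R}) (g : {poly {poly R}}) (N : nat).
Variables (h : nat -> R -> R) (hs : R -> nat -> R -> R) (gam : nat -> R).
Implicit Types (eps r eta : R).
Notation tau := ((pi : R) *+ 2).
Notation P := (\poly_(k < N) gam k).
Hypothesis g0 : forall y, g.[0%:P].[y] = 0.
Hypothesis bounded_h : exists M, forall k phi, `|h k phi| <= M.
Hypothesis cont_h : forall k, continuous (h k).
Hypothesis per_h : forall k, periodic (h k) tau.
Hypothesis mean_h : forall k, has_mean (fun phi => cos phi * h k phi) (gam k).
Hypothesis bounded_hs : forall sigma, `|sigma| = 1 ->
  exists M, forall k phi, `|hs sigma k phi| <= M.
Hypothesis cont_hs : forall sigma k, `|sigma| = 1 -> continuous (hs sigma k).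
Hypothesis field_h : forall eps, polar_field N h eps (planar_field f g eps).
Hypothesis field_hs : forall eps sigma, `|sigma| = 1 ->
  polar_field N (hs sigma) eps (field_of f g eps sigma).
Hypothesis cont_pert : forall c1 c2 : R -> R, continuous c1 -> continuous c2 ->
  continuous (fun t => f.[c1 t] * c2 t + Num.sg (c1 t) * g.[(c1 t)%:P].[c2 t]).

Lemma no_orbit_near r : 0 < r -> P.[r] != 0 -> exists eta e0, [/\ 0 < eta, 0 < e0 &
  forall eps G, 0 < `|eps| < e0 -> periodic_orbit f g eps G -> ~ (G `<=` annulus r eta)].
Proof.
move=> r0 Pr.
have [eta [e1 [eta0 e10 H1]]] := no_periodic_slope_solution bounded_h mean_h r0 Pr.
have [e2 e20 H2] := orbit_slope_solution g0 bounded_h field_h cont_pert r0.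
exists (Num.min eta r * r), (Num.min e1 e2); split.
- by rewrite mulr_gt0// lt_min eta0.
- by rewrite lt_min e10.
- move=> eps G; rewrite lt_min => /and3P[eps0 l1 l2] po Ga.
  have [|Rf [k [sol Rr k0 per _]]] := H2 eps (Num.min eta r) G l2 _ po Ga.
    by rewrite lt_min eta0 r0 ge_min lexx orbT.
  apply: (H1 eps Rf k) => //; first by rewrite eps0.
    by move=> phi; have := Rr phi; rewrite lt_min => /andP[].
Qed.

Lemma unique_orbit_near r : 0 < r -> P.[r] = 0 -> P^`().[r] != 0 ->
  exists2 eta, 0 < eta & exists2 e0, 0 < e0 &
  forall eps G1 G2, 0 < `|eps| < e0 -> periodic_orbit f g eps G1 ->
  periodic_orbit f g eps G2 -> G1 `<=` annulus r eta -> G2 `<=` annulus r eta -> G1 = G2.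
Proof.
move=> r0 Pr P'r.
have [eta [e1 [eta0 e10 H1]]] := unique_periodic_slope_solution bounded_h mean_h r0 Pr P'r.
have [e2 e20 H2] := orbit_slope_solution g0 bounded_h field_h cont_pert r0.
exists (Num.min eta r * r); first by rewrite mulr_gt0// lt_min eta0.
exists (Num.min e1 e2); first by rewrite lt_min e10.
move=> eps G1 G2; rewrite lt_min => /and3P[eps0 l1 l2] po1 po2 Ga1 Ga2.
have er : 0 < Num.min eta r <= r by rewrite lt_min eta0 r0 ge_min lexx orbT.
have [R1 [k1 [sol1 Rr1 k10 per1 ->]]] := H2 eps (Num.min eta r) G1 l2 er po1 Ga1.
have [R2 [k2 [sol2 Rr2 k20 per2 ->]]] := H2 eps (Num.min eta r) G2 l2 er po2 Ga2.
suff -> : R1 = R2 by [].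
apply: (H1 eps R1 R2 k1 k2) => //; first by rewrite eps0.
- by move=> phi; have := Rr1 phi; rewrite lt_min => /andP[].
- by move=> phi; have := Rr2 phi; rewrite lt_min => /andP[].
Qed.

Lemma exists_orbit_near r eta : 0 < r -> P.[r] = 0 -> P^`().[r] != 0 -> 0 < eta ->
  exists2 e0, 0 < e0 & forall eps, 0 < `|eps| < e0 -> exists G,
  [/\ periodic_orbit f g eps G, G `<=` annulus r eta & hausdorff_close eta G (circle r)].
Proof.
move=> r0 Pr P'r eta0.
have [e1 e10 H1] := slope_solution_orbit g0 bounded_h cont_h per_h bounded_hs
  cont_hs field_h field_hs r0.
(* If the radius stays below 2r, its square differs from r^2 by at most 3r times its distance to
   r. *)
have m0 : 0 < Num.min eta (Num.min r (eta / (3 * r))).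
  by rewrite !lt_min eta0 r0 divr_gt0// mulr_gt0.
have [e2 e20 H2] := exists_periodic_slope_solution bounded_h cont_h per_h mean_h
  r0 Pr P'r m0.
exists (Num.min e1 e2); first by rewrite lt_min e10.
move=> eps; rewrite lt_min => /and3P[eps0 l1 l2].
have [|Rf [sol Rr per]] := H2 eps; first by rewrite eps0.
have {}Rr phi : [/\ `|Rf phi - r| < eta, `|Rf phi - r| < r &
    `|Rf phi - r| * (3 * r) < eta].
  by have := Rr phi; rewrite !lt_min ltr_pdivlMr ?mulr_gt0// => /and3P[].
exists (range (polar_curve Rf)); split.
- apply: (H1 eps Rf) => // phi; have [_ + _] := Rr phi.
  by rewrite ltr_norml => /andP[? ?]; apply/andP; split; lra.
- move=> _ [phi _ <-]; have [_ H3 H4] := Rr phi.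
  rewrite /annulus /polar_curve /= !exprMn -mulrDr [sin phi ^+ 2 + _]addrC cos2Dsin2 mulr1.
  rewrite subr_sqr normrM; apply: le_lt_trans H4; rewrite ler_wpM2l//.
  move: H3; rewrite ltr_norml => /andP[? ?].
  by rewrite ger0_norm; lra.
- by apply: polar_curve_close => // phi; have [] := Rr phi.
Qed.

Variables (H : nat) (rs : 'I_H -> R).
Hypothesis rs_inj : injective rs.
Hypothesis rs_gt0 : forall i, 0 < rs i.
Hypothesis rs_root : forall i, P.[rs i] = 0.
Hypothesis rs_simple : forall i, P^`().[rs i] != 0.
Hypothesis rs_all : forall r, 0 < r -> P.[r] = 0 -> exists i, r = rs i.

(** A periodic orbit is chosen for each eps separately, inside a fixed annulus around each root.
    Uniqueness in that annulus makes the orbit isolated, and also gives convergence: the orbit known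
    to exist in a thinner annulus must be the chosen one. *)
Lemma at_least_roots : at_least_bifurcating f g H.
Proof.
(* Annuli of this width around different roots are disjoint, hence the cycles found in them are
   distinct. *)
have [eta1 eta10 sep] : exists2 e, 0 < e & forall ij : 'I_H * 'I_H, ij.1 != ij.2 ->
    2 * e <= `|rs ij.1 ^+ 2 - rs ij.2 ^+ 2|.
  apply: common_positive_bound => [[i j]|[i j] e e' /andP[_ le] Q ij] /=; last first.
    by apply: le_trans (Q ij); lra.
  have [->|ij] := eqVneq i j; first by exists 1 => //; rewrite eqxx.
  exists (`|rs i ^+ 2 - rs j ^+ 2| / 2); last by move=> _; lra.
  rewrite divr_gt0// normr_gt0 subr_eq0 eqrXn2 ?ltW//.
  by apply: contra_neq ij; exact: rs_inj.
have [eta2 eta20 uniq] : exists2 e, 0 < e & forall i, exists2 e0, 0 < e0 &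
    forall eps G1 G2, 0 < `|eps| < e0 -> periodic_orbit f g eps G1 ->
    periodic_orbit f g eps G2 -> G1 `<=` annulus (rs i) e ->
    G2 `<=` annulus (rs i) e -> G1 = G2.
  apply: common_positive_bound => [i|i e e' /andP[_ le] [e0 e00 Q]].
    exact: unique_orbit_near.
  exists e0 => // eps G1 G2 He p1 p2 a1 a2; apply: (Q eps) => //.
  - exact: subset_trans (annulus_sub le).
  - exact: subset_trans (annulus_sub le).
pose eta := Num.min eta1 eta2.
have eta0 : 0 < eta by rewrite lt_min eta10.
have [e1 e10 H1] : exists2 e, 0 < e & forall i, forall eps G1 G2, 0 < `|eps| < e ->
    periodic_orbit f g eps G1 -> periodic_orbit f g eps G2 ->
    G1 `<=` annulus (rs i) eta -> G2 `<=` annulus (rs i) eta -> G1 = G2.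
  apply: common_positive_bound => [i|i e e' /andP[_ le] Q].
    have [e0 e00 Q] := uniq i; exists e0 => // eps G1 G2 He p1 p2 a1 a2.
    have le : eta <= eta2 by rewrite ge_min lexx orbT.
    apply: (Q eps) => //; exact: subset_trans (annulus_sub le).
  by move=> eps G1 G2 /andP[He0 He]; apply: Q; rewrite He0 (lt_le_trans He).
have [e2 e20 H2] : exists2 e, 0 < e & forall i, forall eps, 0 < `|eps| < e -> exists G,
    periodic_orbit f g eps G /\ G `<=` annulus (rs i) eta.
  apply: common_positive_bound => [i|i e e' /andP[_ le] Q].
    have [e0 e00 Q] := exists_orbit_near (rs_gt0 i) (rs_root i) (rs_simple i) eta0.
    by exists e0 => // eps /Q[G [? ? _]]; exists G.
  by move=> eps /andP[He0 He]; apply: Q; rewrite He0 (lt_le_trans He).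
have /choice[G GP] : forall i, exists G : R -> set (R * R), forall eps,
    0 < `|eps| < Num.min e1 e2 ->
    periodic_orbit f g eps (G eps) /\ G eps `<=` annulus (rs i) eta.
  move=> i; have /choice[Gi GiP] : forall eps, exists G0 : set (R * R),
      0 < `|eps| < Num.min e1 e2 ->
      periodic_orbit f g eps G0 /\ G0 `<=` annulus (rs i) eta.
    move=> eps.
    have [He|He] := pselect (0 < `|eps| < Num.min e1 e2); last by exists set0 => /He.
    have [|G GP] := H2 i eps; last by exists G.
    by move: He; rewrite lt_min => /and3P[-> _ ->].
  by exists Gi.
exists (Num.min e1 e2), G, rs; split => //.
- by rewrite lt_min e10.
- move=> eps He; have He1 : 0 < `|eps| < e1.
    by move: He; rewrite lt_min => /and3P[-> ->].
  split => [l|l l' ll' GG].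
  + have [po Ga] := GP l eps He; split => //.
    exists (annulus (rs l) eta); split => //; first exact: open_annulus.
    by move=> G' po' Ga'; exact: (H1 l eps).
  + have [[c [T [_ _ _ _ GE]]] Ga] := GP l eps He; have [_ Ga'] := GP l' eps He.
    have Gc : G l eps (c 0) by rewrite GE; exists 0.
    have := Ga _ Gc; rewrite GG in Gc; have := Ga' _ Gc.
    have := sep (l, l') ll'; rewrite /annulus /=; move=> s; set q := _ + (c 0).2 ^+ 2 => a' a.
    have le : eta <= eta1 by rewrite ge_min lexx.
    have := ler_normB (q - rs l' ^+ 2) (q - rs l ^+ 2).
    have -> : q - rs l' ^+ 2 - (q - rs l ^+ 2) = rs l ^+ 2 - rs l' ^+ 2 by ring.
    by move=> tri; suff : 2 * eta1 < 2 * eta1; [rewrite ltxx|lra].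
- move=> l e0 e00.
  have m0 : 0 < Num.min e0 eta by rewrite lt_min e00.
  have [e3 e30 H3] := exists_orbit_near (rs_gt0 l) (rs_root l) (rs_simple l) m0.
  near=> eps.
  have n0 : 0 < `|eps| by rewrite normr_gt0; near: eps; exact: nbhs_dnbhs_neq.
  have n3 : `|eps| < e3 by near: eps; exact: dnbhs0_lt.
  have n12 : `|eps| < Num.min e1 e2.
    by near: eps; apply: dnbhs0_lt; rewrite lt_min e10.
  have [|po Ga] := GP l eps; first by rewrite n0.
  have [|G' [po' Ga' [h1 h2]]] := H3 eps; first by rewrite n0.
  have -> : G l eps = G'.
    apply: (H1 l eps) => //.
      by move: n12; rewrite n0 lt_min => /andP[->].
    by apply: subset_trans Ga' _; apply: annulus_sub; rewrite ge_min lexx orbT.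
  split.
  + move=> a /h1[b bc ab]; exists b => //.
    by apply: le_ball ab; rewrite ge_min lexx.
  + move=> a /h2[b bc ab]; exists b => //.
    by apply: le_ball ab; rewrite ge_min lexx.
Unshelve. all: by end_near. Qed.

(** Every limit radius is a root, since no periodic orbit stays near another circle. With H + 1
    families two share the same limit, so for small eps both lie in one annulus of uniqueness and
    coincide. *)
Lemma at_most_roots : ~ at_least_bifurcating f g H.+1.
Proof.
move=> [eps0 [G [r [eps00 lc r0 cvG]]]].
have limc l eps : 0 < `|eps| < eps0 -> periodic_orbit f g eps (G l eps).
  by move=> He; have [/(_ l) []] := lc eps He.
have rootP l : P.[r l] = 0.
  apply/eqP/negPn/negP => Pr.
  have [eta [e0 [eta0 e00 no]]] := no_orbit_near (r0 l) Pr.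
  have [d d0 Hd] := hausdorff_close_annulus (r0 l) eta0.
  have cl := cvG l d d0.
  near (0 : R)^' => eps.
  have n0 : 0 < `|eps| by rewrite normr_gt0; near: eps; exact: nbhs_dnbhs_neq.
  have n1 : `|eps| < e0 by near: eps; exact: dnbhs0_lt.
  have n2 : `|eps| < eps0 by near: eps; exact: dnbhs0_lt.
  apply: (no eps (G l eps)); first by rewrite n0.
  - by apply: limc; rewrite n0.
  - by apply: Hd; near: eps.
have /choice[i iP] : forall l, exists i, r l = rs i.
  by move=> l; exact: rs_all.
have [/injectiveP inj_i|] := boolP (injectiveb i).
  by have := leq_card i inj_i; rewrite !card_ord ltnn.
move=> /injectivePn[l [l' ll' ii]].
have rl : r l = rs (i l) by [].
have rl' : r l' = rs (i l) by rewrite iP ii.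
have [eta eta0 [e0 e00 uq]] := unique_orbit_near (rs_gt0 (i l)) (rs_root (i l)) (rs_simple (i l)).
have [d d0 Hd] := hausdorff_close_annulus (rs_gt0 (i l)) eta0.
have cl := cvG l d d0; have cl' := cvG l' d d0; rewrite rl in cl; rewrite rl' in cl'.
near (0 : R)^' => eps.
have n0 : 0 < `|eps| by rewrite normr_gt0; near: eps; exact: nbhs_dnbhs_neq.
have n1 : `|eps| < e0 by near: eps; exact: dnbhs0_lt.
have n2 : `|eps| < eps0 by near: eps; exact: dnbhs0_lt.
have He : 0 < `|eps| < eps0 by rewrite n0.
have [_ /(_ l l' ll')] := lc eps He; apply.
apply: (uq eps); [by rewrite n0|exact: limc|exact: limc| |].
- by apply: Hd; near: eps.
- by apply: Hd; near: eps.
Unshelve. all: by end_near. Qed.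

End Bifurcation.

(** * Sparse polynomials with prescribed positive roots *)

Section Descartes.
Variable R : realType.
Implicit Types (p q : {poly R}) (s : seq R) (x y : R).

Lemma poly_rolle p x y : x < y -> root p x -> root p y ->
  exists2 c, x < c < y & root p^`() c.
Proof.
move=> xy /eqP px /eqP py.
have [c] := @MVT R (horner p) _ x y xy (fun z _ => is_derive_poly p z)
  (continuous_subspaceT (is_derive_continuous (is_derive_poly p))).
rewrite px py subrr in_itv/= => cxy /esym/eqP.
by rewrite mulf_eq0 (gt_eqF (_ : 0 < y - x)) ?subr_gt0// orbF; exists c.
Qed.

Lemma rolle_seq p x s : path <%R x s -> all (root p) (x :: s) ->
  exists s', [/\ size s' = size s, path <%R x s' & all (root p^`()) s'].
Proof.
elim: s x => [|y s IH] x /=; first by exists [::].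
move=> /andP[xy ys] /and3P[px py ps].
have [|s' [sz pth rt]] := IH y ys; first by rewrite /= py.
have [c /andP[xc cy] rc] := poly_rolle xy px py.
exists (c :: s'); rewrite /= sz xc rc; split => //=.
move: pth; rewrite !(path_sortedE lt_trans) => /andP[ally ->]; rewrite andbT.
by apply: sub_all ally => z; exact: lt_trans.
Qed.

(** A double root z is itself a root of the derivative, in addition to those that Rolle puts
    strictly between consecutive roots. The bound by x keeps the new list positive. *)
Lemma rolle_seq_double p x s z : path <%R x s -> all (root p) (x :: s) ->
  z \in x :: s -> root p^`() z ->
  exists s', [/\ size s' = (size s).+1, sorted <%R s', all (>= x) s' &
    all (root p^`()) s'].
Proof.
move=> + + + rz; elim: s x => [|y s IH] x.
  by rewrite inE => _ _ /eqP <-; exists [:: z]; rewrite /= lexx rz.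
rewrite inE => pth rts; have [zx _|zx /= zys] := eqVneq z x.
  have [s' [sz pth' rt']] := rolle_seq pth rts.
  exists (x :: s'); rewrite /= sz lexx; split => //=; last by rewrite rt' andbT -zx.
  move: pth'; rewrite (path_sortedE lt_trans) => /andP[h _].
  by apply: sub_all h => w /ltW.
move: pth rts => /= /andP[xy ys] /and3P[px py ps].
have [|//|s' [sz srt ge rt]] := IH y ys; first by rewrite /= py.
have [c /andP[xc cy] rc] := poly_rolle xy px py.
exists (c :: s'); rewrite /= sz rc (ltW xc); split => //=.
- rewrite (path_sortedE lt_trans) srt andbT.
  by apply: sub_all ge => w; exact: lt_le_trans.
- by apply: sub_all ge => w /(lt_le_trans xy)/ltW.
Qed.

Definition nb_monomials n p := (\sum_(i < n) (p`_i != 0)%R)%N.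

Lemma nb_monomials_deriv n p :
  nb_monomials n.+1 p = ((p`_0 != 0)%R + nb_monomials n p^`()%R)%N.
Proof.
rewrite /nb_monomials big_ord_recl; congr addn; apply: eq_bigr => i _.
by rewrite coef_deriv mulrn_eq0 lift0.
Qed.

Lemma size_deriv_le n p : (size p <= n.+1)%N -> (size (p^`())%R <= n)%N.
Proof.
have [->|p0] := eqVneq p 0; first by rewrite deriv0 size_poly0.
by move=> sp; rewrite -ltnS (leq_trans (lt_size_deriv p0)).
Qed.

Lemma coef0_eq0_factor n p : (size p <= n.+1)%N -> p != 0 -> p`_0 = 0 ->
  exists q, [/\ p = q * 'X, q != 0, (size q <= n)%N &
    nb_monomials n.+1 p = nb_monomials n q].
Proof.
move=> szp p0 pc.
have [q pq] : exists q, p = q * 'X.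
  have /factor_theorem[q] : root p 0 by rewrite rootE horner_coef0 pc.
  by rewrite subr0; exists q.
have q0 : q != 0 by apply: contra_neq p0; rewrite pq => ->; rewrite mul0r.
exists q; split => //; first by move: szp; rewrite pq size_mulX.
rewrite /nb_monomials big_ord_recl /= pc eqxx add0n; apply: eq_bigr => i _.
by rewrite pq coefMX.
Qed.

Lemma deriv_neq0_of_root p x : p`_0 != 0 -> root p x -> p^`() != 0.
Proof.
move=> pc rx; apply/eqP => dp.
have pE : p = (p`_0)%:P.
  apply/polyP => -[|i]; rewrite coefC//=.
  have := congr1 (fun r : {poly R} => r`_i) dp; rewrite coef_deriv coef0 => /eqP.
  by rewrite mulrn_eq0 => /eqP.
by move: rx pc; rewrite pE rootC coefC => ->.
Qed.

(* If the constant term vanishes we divide by 'X; otherwise differentiation costs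
   one monomial and, by Rolle, one root. *)
Lemma positive_roots_lt_monomials n p s : (size p <= n)%N -> p != 0 ->
  sorted <%R s -> all (> 0) s -> all (root p) s -> (size s < nb_monomials n p)%N.
Proof.
elim: n p s => [|n IH] p s szp p0.
  by move: szp; rewrite leqn0 size_poly_eq0 (negbTE p0).
have [pc|pc] := eqVneq p`_0 0.
  have [q [pq q0 szq ->]] := coef0_eq0_factor szp p0 pc.
  move=> srt pos rts; apply: IH => //.
  apply/allP => x xs; have /allP/(_ x xs) := rts; have /allP/(_ x xs) x0 := pos.
  by rewrite pq rootM rootX (gt_eqF x0) orbF.
rewrite nb_monomials_deriv pc add1n ltnS => srt pos rts.
case: s srt pos rts => [//|x s] srt /= /andP[x0 pos] rts.
have [s' [sz pth rt]] := rolle_seq srt rts.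
rewrite -sz; apply: IH => //; first exact: size_deriv_le.
- by have /andP[rx _] := rts; exact: deriv_neq0_of_root rx.
- by move: pth; rewrite (path_sortedE lt_trans) => /andP[].
- move: pth; rewrite (path_sortedE lt_trans) => /andP[h _].
  by apply: sub_all h => w; exact: lt_trans.
Qed.

(** If the constant term is nonzero, a double root would give the derivative as many positive roots
    as it has monomials, one more than Descartes allows. *)
Lemma extremal_positive_roots_simple n p s z : (size p <= n)%N -> p != 0 ->
  sorted <%R s -> all (> 0) s -> all (root p) s ->
  (size s).+1 = nb_monomials n p -> z \in s -> p^`().[z] != 0.
Proof.
elim: n p s => [|n IH] p s szp p0.
  by move: szp; rewrite leqn0 size_poly_eq0 (negbTE p0).
have [pc|pc] := eqVneq p`_0 0.
  have [q [pq q0 szq ->]] := coef0_eq0_factor szp p0 pc.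
  move=> srt pos rts E zs.
  have qrts : all (root q) s.
    apply/allP => x xs; have /allP/(_ x xs) := rts; have /allP/(_ x xs) x0 := pos.
    by rewrite pq rootM rootX (gt_eqF x0) orbF.
  have /allP/(_ z zs)/= z0 := pos.
  have := IH q s szq q0 srt pos qrts E zs; have /allP/(_ z zs)/eqP qz := qrts.
  by move=> dq; rewrite pq derivM derivX mulr1 hornerD hornerMX qz addr0 mulf_neq0// gt_eqF.
rewrite nb_monomials_deriv pc add1n => srt pos rts E zs; apply/negP => rz.
case: s srt pos rts E zs => [//|x s] srt /= /andP[x0 pos] rts E zs.
have [s' [sz pth ge rt]] := rolle_seq_double srt rts zs rz.
have dp0 : p^`() != 0 by have /andP[rx _] := rts; exact: deriv_neq0_of_root rx.
have pos' : all (> 0) s' by apply: sub_all ge => w; exact: lt_le_trans.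
have := positive_roots_lt_monomials (size_deriv_le szp) dp0 pth pos' rt.
by case: E => <-; rewrite sz ltnn.
Qed.

(** The coefficients are a nonzero row vector in the kernel of the matrix of values at 1, ..., H,
    which has H + 1 rows and H columns. H positive roots force all H + 1 coefficients to be nonzero;
    this is what gives f and g their exact degrees later. *)
Lemma sparse_poly_prescribed_roots (N H : nat) (S : pred nat) :
  (\sum_(k < N) S k = H.+1)%N -> exists c : nat -> R,
  [/\ forall k, (k < N)%N -> (c k != 0) = S k,
      forall i : 'I_H, (\poly_(k < N) c k).[i.+1%:R] = 0,
      forall i : 'I_H, (\poly_(k < N) c k)^`().[i.+1%:R] != 0 &
      forall r, 0 < r -> (\poly_(k < N) c k).[r] = 0 -> exists i : 'I_H, r = i.+1%:R].
Proof.
move=> sumS; pose T := [pred k : 'I_N | S k].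
have cT : #|T| = H.+1 by rewrite -sumS -sum1_card big_mkcond.
pose e (i : 'I_#|T|) : 'I_N := @enum_val _ T i.
pose A : 'M[R]_(#|T|, H) := \matrix_(i, j) (j.+1%:R ^+ e i).
pose u := nz_row (kermx A).
have u0 : u != 0.
  rewrite nz_row_eq0 -mxrank_eq0 mxrank_ker -lt0n subn_gt0.
  by rewrite (leq_ltn_trans (rank_leq_col A))// cT.
have uA : u *m A = 0 by apply/sub_kermxP; exact: nz_row_sub.
pose c k := \sum_(i < #|T|) (if (e i : nat) == k then u 0 i else 0).
pose p := \poly_(k < N) c k.
have cE i : c (e i) = u 0 i.
  rewrite /c (bigD1 i)//= eqxx big1 ?addr0// => j ji; rewrite ifF//.
  by apply/negbTE; apply: contra ji => /eqP/val_inj/enum_val_inj ->.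
have cS k : ~~ S k -> c k = 0.
  move=> nS; rewrite /c big1// => i _; case: eqP => // E.
  by have := @enum_valP _ T i; rewrite inE -/(e i) E (negbTE nS).
have hornerp x : p.[x] = \sum_(i < #|T|) u 0 i * x ^+ e i.
  rewrite horner_poly; under eq_bigr do rewrite mulr_suml.
  rewrite exchange_big /=; apply: eq_bigr => i _.
  rewrite (bigD1 (e i))//= eqxx big1 ?addr0// => k ki.
  by rewrite ifF ?mul0r//; apply/negbTE; rewrite eq_sym.
have p0 : p != 0.
  have [i ui] : exists i, u 0 i != 0.
    apply/existsP; apply: contraR u0 => /existsPn un; apply/eqP/rowP => i.
    by rewrite mxE; have := un i; rewrite negbK => /eqP.
  apply/eqP => /(congr1 (fun q : {poly R} => q`_(e i))).
  by rewrite coef_poly ltn_ord cE coef0 => /eqP; rewrite (negbTE ui).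
have roots (i : 'I_H) : p.[i.+1%:R] = 0.
  transitivity ((u *m A) 0 i); last by rewrite uA mxE.
  by rewrite hornerp mxE; apply: eq_bigr => j _; rewrite [A _ _]mxE.
have szp : (size p <= N)%N by exact: size_poly.
pose s : seq R := [seq i.+1%:R | i <- iota 0 H].
have szs : size s = H by rewrite size_map size_iota.
have srt : sorted <%R s.
  rewrite /s sorted_map; apply: (@sub_sorted _ ltn); last exact: iota_ltn_sorted.
  by move=> i j /= ij; rewrite ltr_nat ltnS.
have pos : all (> 0) s by apply/allP => _ /mapP[i _ ->]; rewrite ltr0n.
have rts : all (root p) s.
  apply/allP => _ /mapP[i +->]; rewrite mem_iota add0n => /andP[_ iH].
  by have := roots (Ordinal iH) => /= /eqP.
have le k : ((p`_k != 0)%R <= S k)%N.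
  rewrite /p coef_poly; have [Sk|/cS ck] := boolP (S k); first exact: leq_b1.
  by case: ifP; rewrite ?ck eqxx.
have nb : nb_monomials N p = H.+1.
  apply/eqP; rewrite eqn_leq -{2}szs (positive_roots_lt_monomials szp) // andbT.
  by rewrite -sumS; apply: leq_sum => k _; exact: le.
exists c; split => //.
- move=> k kN; have [Sk|nS] := boolP (S k); last by rewrite cS ?eqxx.
  apply/negP => /eqP ck.
  have : (nb_monomials N p < \sum_(k < N) S k)%N.
    rewrite /nb_monomials (bigD1 (Ordinal kN))//= [ltnRHS](bigD1 (Ordinal kN))//=.
    rewrite coef_poly kN ck eqxx Sk add0n add1n ltnS.
    by apply: leq_sum => j _; exact: le.
  by rewrite nb sumS ltnn.
- move=> i; apply: (@extremal_positive_roots_simple N p s) => //; first by rewrite szs.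
  by apply/mapP; exists (i : nat) => //; rewrite mem_iota add0n ltn_ord.
- move=> r r0 pr; apply: contrapT => nr.
  pose s' := sort <=%R (r :: s).
  have us' : uniq (r :: s).
    rewrite /= (sorted_uniq lt_trans ltxx srt) andbT; apply/negP => /mapP[i].
    by rewrite mem_iota add0n => /andP[_ iH] ri; apply: nr; exists (Ordinal iH).
  have := @positive_roots_lt_monomials N p s' szp p0.
  rewrite /s' sort_lt_sorted us' !all_sort size_sort /= r0 pos rts nb szs.
  rewrite rootE pr eqxx => /(_ isT isT isT); by rewrite ltnn.
Qed.

End Descartes.

(** * The example *)

Section Means.
Variable R : realType.
Implicit Types (phi x : R) (F : R -> R).
Notation tau := ((pi : R) *+ 2).

Lemma has_mean_antiperiodic F : continuous F -> alternating F pi -> has_mean F 0.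
Proof.
move=> cF aF; have [G G0 dG] := antiderivative 0 cF.
have D0 (s : R) : is_derive s 1 (fun s => G (s + pi) + G s) 0.
  have -> : 0 = F (s + pi) + F s by rewrite aF addNr.
  by apply: is_deriveD; exact: is_derive_shiftr.
exists G => // t; rewrite mulr2n addrA addr0.
by have := is_derive_0_is_cst (t + pi) t D0; rewrite /=; lra.
Qed.

(** The reason for taking odd powers of x in g: multiplied by the sign they are continuous. *)
Lemma sgX_odd x k : odd k -> Num.sg x * x ^+ k = `|x| ^+ k.
Proof.
move=> ok; have [x0|x0|<-] := ltgtP 0 x.
- by rewrite gtr0_sg// mul1r gtr0_norm.
- by rewrite ltr0_sg// ltr0_norm// exprNn -signr_odd ok expr1.
- by rewrite normr0 sgr0 mul0r expr0n; case: k ok.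
Qed.

Lemma normX_even x k : ~~ odd k -> x ^+ k = `|x| ^+ k.
Proof. by move=> ek; rewrite -normrX ger0_norm// exprn_even_ge0. Qed.

(** The integrand is nonnegative everywhere and positive inside the first quarter turn, where the
    mean value theorem yields a positive increment. *)
Lemma positive_mean k : exists2 a, 0 < a &
  has_mean (fun phi : R => cos phi ^+ 2 * `|sin phi| ^+ k) a.
Proof.
pose F phi : R := cos phi ^+ 2 * `|sin phi| ^+ k.
have F0 phi : 0 <= F phi by rewrite mulr_ge0 ?sqr_ge0 ?exprn_ge0.
have cF : continuous F.
  move=> t; apply: cvgM.
    by apply: (@continuous_comp _ _ _ (@cos R) (fun x => x ^+ 2));
      [exact: continuous_cos|exact: exprn_continuous].
  apply: (@continuous_comp _ _ _ (fun s => `|sin s| : R) (fun x => x ^+ k)).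
    by apply: (@continuous_comp _ _ _ (@sin R) (fun x => `|x|));
      [exact: continuous_sin|exact: norm_continuous].
  exact: exprn_continuous.
have pF : periodic F tau by move=> phi; rewrite /F sinD2pi cosD2pi.
have [a aF] := has_mean_periodic cF pF; exists a => //.
have [G dG G1] := aF.
have pi2 : 0 < pi / 2 :> R by rewrite divr_gt0// pi_gt0.
have pt : pi / 2 <= tau by rewrite [tau]mulr2n; have := pi_gt0 R; lra.
have [x] := @MVT R G F 0 (pi / 2) pi2 (fun x _ => dG x)
  (continuous_subspaceT (is_derive_continuous dG)).
rewrite in_itv/= => xi Gx.
have Fx : 0 < F x.
  rewrite mulr_gt0// exprn_gt0 ?normr_gt0 ?gt_eqF//.
  - by apply: cos_gt0_pihalf; have := pi_gt0 R; lra.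
  - exact: sin_gt0_pihalf.
have := derive_ge0_le pt dG (fun t _ => F0 t).
have := G1 0; rewrite add0r => ->.
by have := mulr_gt0 Fx pi2; move: Gx; rewrite subr0; lra.
Qed.

End Means.

Section Example.
Variables (R : realType) (n m : nat) (q : nat -> R).
Hypothesis hm : (2 <= m)%N.
Implicit Types (x y phi r s co : R).
Notation tau := ((pi : R) *+ 2).

(* The exponents of the averaged polynomial: even ones come from f, odd ones
   from g. *)
Definition monomial_exponents k := if odd k then (k < m)%N else (k <= n)%N.
Notation S := monomial_exponents.
Notation N := (n + m).+1.

(* The summand x^n for odd n, resp. x^m for odd m, only serves to reach the exact
   degree: its average vanishes. *)
Definition damping : {poly R} :=
  \poly_(k < n.+1) (if odd k then (k == n)%:R else q k).

Definition switched : {poly {poly R}} :=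
  \poly_(k < m.+1) (if odd k then (if k == m then 1 else q k *: 'X) else 0).

(** The coefficient of r^k in the perturbation divided by r, at sine s and cosine co. The summand
    x^m of g has no factor y, so after division by r it appears at exponent [m.-1]. The parameter
    sigma covers X, Y and, as the sign of s, the continuous field. *)
Definition angular_coef (sigma s co : R) k :=
  (S k)%:R * q k * (if odd k then sigma else 1) * s ^+ k * co +
  (odd n && (k == n))%:R * s ^+ n * co + (odd m && (k == m.-1))%:R * sigma * s ^+ m.

Lemma sum_monomial_exponents : (\sum_(k < N) S k = (Hmn m n).+1)%N.
Proof.
have odds M : (\sum_(k < M) (odd k && (k < m)) = (minn M m)./2)%N.
  elim: M => [|M IH]; first by rewrite big_ord0; lia.
  by rewrite big_ord_recr /= IH; lia.
have evens M : (\sum_(k < M) (~~ odd k && (k <= n)) = (minn M n.+1).+1./2)%N.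
  elim: M => [|M IH]; first by rewrite big_ord0; lia.
  by rewrite big_ord_recr /= IH; lia.
have -> : (\sum_(k < N) S k =
    \sum_(k < N) (odd k && (k < m)) + \sum_(k < N) (~~ odd k && (k <= n)))%N.
  by rewrite -big_split; apply: eq_bigr => k _; rewrite /S; case: odd => /=; rewrite ?addn0.
rewrite odds evens /Hmn; lia.
Qed.

Lemma widen_sum (M : nat) (F : nat -> R) : (M <= N)%N ->
  \sum_(k < M) F k = \sum_(k < N) (k < M)%N%:R * F k.
Proof.
move=> MN; rewrite (big_ord_widen _ _ MN) big_mkcond; apply: eq_bigr => k _.
by case: ifP => _; rewrite ?mul1r ?mul0r.
Qed.

Lemma switched_eval x y : switched.[x%:P].[y] =
  \sum_(k < m.+1) (if odd k then (if k == m :> nat then 1 else q k * y) else 0) * x ^+ k.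
Proof.
rewrite horner_poly horner_sum; apply: eq_bigr => k _.
rewrite -polyC_exp hornerM hornerC; congr (_ * _).
by case: ifP => _; [case: ifP => _; rewrite ?hornerC ?hornerZ ?hornerX|rewrite horner0].
Qed.

Lemma perturbation_polar sigma r s co :
  damping.[r * s] * (r * co) + sigma * switched.[(r * s)%:P].[r * co] =
  r * \sum_(k < N) angular_coef sigma s co k * r ^+ k.
Proof.
rewrite switched_eval horner_poly.
rewrite (@widen_sum n.+1 (fun k => (if odd k then (k == n)%:R else q k) * (r * s) ^+ k));
  last lia.
rewrite (@widen_sum m.+1 (fun k => (if odd k then
  (if k == m then 1 else q k * (r * co)) else 0) * (r * s) ^+ k)); last lia.
have -> : \sum_(k < N) angular_coef sigma s co k * r ^+ k =
  \sum_(k < N) ((S k)%:R * q k * (if odd k then sigma else 1) * s ^+ k * co * r ^+ k +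
    (odd n && (k == n :> nat))%:R * s ^+ n * co * r ^+ n) +
  \sum_(k < N) (odd m && (k == m.-1 :> nat))%:R * sigma * s ^+ m * r ^+ m.-1.
  rewrite -big_split; apply: eq_bigr => k _ /=; rewrite /angular_coef.
  have -> : (odd n && (k == n :> nat))%:R * s ^+ n * co * r ^+ n =
     (odd n && (k == n :> nat))%:R * s ^+ n * co * r ^+ k.
    by have [->|] := eqVneq (k : nat) n; rewrite ?andbF ?mul0r.
  have -> : (odd m && (k == m.-1 :> nat))%:R * sigma * s ^+ m * r ^+ m.-1 =
    (odd m && (k == m.-1 :> nat))%:R * sigma * s ^+ m * r ^+ k.
    by have [->|] := eqVneq (k : nat) m.-1; rewrite ?andbF ?mul0r.
  by rewrite !mulrDl.
(* This summand is moved from index [m.-1], its power of r, to index m, its power of x, so that the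
   two sides can be compared index by index. *)
have -> : \sum_(k < N) (odd m && (k == m.-1 :> nat))%:R * sigma * s ^+ m * r ^+ m.-1 =
  \sum_(k < N) (odd m && (k == m :> nat))%:R * sigma * s ^+ m * r ^+ m.-1.
  rewrite -!mulr_suml; congr (_ * _ * _ * _).
  have mN : (m < N)%N by lia.
  have m1N : (m.-1 < N)%N by lia.
  rewrite (bigD1 (Ordinal m1N))//= eqxx big1 => [|k]; last first.
    by rewrite -val_eqE /= => /negbTE ->; rewrite andbF.
  rewrite [RHS](bigD1 (Ordinal mN))//= eqxx big1 => // k.
  by rewrite -val_eqE /= => /negbTE ->; rewrite andbF.
rewrite -big_split mulr_suml !mulr_sumr -big_split /=; apply: eq_bigr => k _.
have [m' mE] : exists m', m = m'.+1 by exists m.-1; lia.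
rewrite /S !ltnS !exprMn.
have [->|kn] := eqVneq (k : nat) n.
  rewrite leqnn andbT.
  have [nm|nm] := eqVneq n m.
    rewrite nm ltnn leqnn andbT; case: ifP => om; rewrite ?om /= mE /= ?exprS; ring.
  rewrite andbF; case: ifP => on /=; last by ring.
  by rewrite (leq_eqVlt n) (negbTE nm) /=; ring.
rewrite andbF; have [->|km] := eqVneq (k : nat) m.
  rewrite leqnn ltnn andbT; case: ifP => om; rewrite ?om /= mE /= ?exprS; ring.
rewrite andbF (leq_eqVlt k m) (negbTE km) /=; case: ifP => ok /=; ring.
Qed.

Lemma switched0 y : switched.[0%:P].[y] = 0.
Proof.
by rewrite switched_eval big1// => -[[|k] /= _] _; rewrite ?mul0r// exprS mul0r mulr0.
Qed.

Lemma size_damping : (~~ odd n -> q n != 0) -> poly_degree damping n.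
Proof.
move=> qn; apply: size_poly_eq => /=; rewrite eqxx.
by case: ifP => [_|/negbT/qn//]; exact: oner_neq0.
Qed.

Lemma total_degree_switched : (~~ odd m -> q m.-1 != 0) -> total_degree switched m.
Proof.
move=> qm; split.
- move=> i j; rewrite coef_poly; case: ifP => [|_]; last by rewrite coef0 eqxx.
  rewrite ltnS => im; case: ifP => [_|_]; last by rewrite coef0 eqxx.
  have [->|im'] := eqVneq i m; first by rewrite coef1; case: j => [|j]; rewrite ?addn0 ?eqxx.
  rewrite coefZ coefX; case: (eqVneq j 1%N) => [->|_]; last by rewrite mulr0 eqxx.
  lia.
- have [om|em] := boolP (odd m).
    exists m, 0%N; rewrite addn0 coef_poly ltnSn om eqxx coef1; split => //.
    exact: oner_neq0.
  (* For even m the degree is reached by the monomial x^(m-1) y. *)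
  exists m.-1, 1%N; split; first lia.
  rewrite coef_poly ifT; last lia.
  rewrite ifT; last lia.
  rewrite ifF; last lia.
  by rewrite coefZ coefX mulr1 qm.
Qed.

(** As r is positive, the sign of x is that of sin phi. *)
Definition field_coef k phi := angular_coef (Num.sg (sin phi)) (sin phi) (cos phi) k.

Lemma field_coefE k phi : field_coef k phi =
  (S k)%:R * q k * `|sin phi| ^+ k * cos phi +
  (odd n && (k == n))%:R * sin phi ^+ n * cos phi +
  (odd m && (k == m.-1))%:R * `|sin phi| ^+ m.
Proof.
rewrite /field_coef /angular_coef; congr (_ + _ + _).
- congr (_ * _); rewrite -!mulrA; congr (_ * (_ * _)).
  by case: (boolP (odd k)) => [/sgX_odd->|/normX_even->]//; rewrite mul1r.
- case: (boolP (odd m)) => [om|]; last by rewrite !mul0r.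
  by rewrite -mulrA sgX_odd.
Qed.

Lemma continuous_trig_pow (i j : nat) : continuous (fun phi => sin phi ^+ i * cos phi ^+ j).
Proof.
move=> t; apply: cvgM.
- by apply: (@continuous_comp _ _ _ (@sin R) (fun x => x ^+ i));
    [exact: continuous_sin|exact: exprn_continuous].
- by apply: (@continuous_comp _ _ _ (@cos R) (fun x => x ^+ j));
    [exact: continuous_cos|exact: exprn_continuous].
Qed.

Lemma continuous_abs_sin_pow (i j : nat) :
  continuous (fun phi => `|sin phi| ^+ i * cos phi ^+ j).
Proof.
move=> t; apply: cvgM.
- apply: (@continuous_comp _ _ _ (fun s : R => `|sin s|) (fun x => x ^+ i)).
    by apply: (@continuous_comp _ _ _ (@sin R) (fun x => `|x|));
      [exact: continuous_sin|exact: norm_continuous].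
  exact: exprn_continuous.
- by apply: (@continuous_comp _ _ _ (@cos R) (fun x => x ^+ j));
    [exact: continuous_cos|exact: exprn_continuous].
Qed.

Lemma continuous_field_coef k : continuous (field_coef k).
Proof.
have -> : field_coef k = fun phi =>
    (S k)%:R * q k * (`|sin phi| ^+ k * cos phi ^+ 1) +
    (odd n && (k == n))%:R * (sin phi ^+ n * cos phi ^+ 1) +
    (odd m && (k == m.-1))%:R * (`|sin phi| ^+ m * cos phi ^+ 0).
  by apply/funext => phi; rewrite field_coefE expr0 expr1 mulr1 !mulrA.
move=> t; apply: cvgD; [apply: cvgD|]; apply: cvgM; try exact: cvg_cst.
- exact: continuous_abs_sin_pow.
- exact: continuous_trig_pow.
- exact: continuous_abs_sin_pow.
Qed.

Lemma continuous_angular_coef sigma k :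
  continuous (fun phi => angular_coef sigma (sin phi) (cos phi) k).
Proof.
have -> : (fun phi => angular_coef sigma (sin phi) (cos phi) k) = fun phi =>
    (S k)%:R * q k * (if odd k then sigma else 1) * (sin phi ^+ k * cos phi ^+ 1) +
    (odd n && (k == n))%:R * (sin phi ^+ n * cos phi ^+ 1) +
    (odd m && (k == m.-1))%:R * sigma * (sin phi ^+ m * cos phi ^+ 0).
  by apply/funext => phi; rewrite /angular_coef expr0 expr1 mulr1 !mulrA.
move=> t; apply: cvgD; [apply: cvgD|]; apply: cvgM; try exact: cvg_cst;
  exact: continuous_trig_pow.
Qed.

Lemma angular_coef_bounded : exists M, forall sigma k phi, `|sigma| <= 1 ->
  `|angular_coef sigma (sin phi) (cos phi) k| <= M.
Proof.
exists (\sum_(k < N) `|q k| + 1 + 1) => sigma k phi sg1.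
have M1 (a b : R) : `|a| <= 1 -> `|b| <= 1 -> `|a * b| <= 1.
  by move=> a1 b1; rewrite normrM mulr_ile1.
have X1 (a : R) i : `|a| <= 1 -> `|a ^+ i| <= 1.
  by move=> a1; rewrite normrX exprn_ile1.
have b1 (b : bool) : `|b%:R : R| <= 1 by case: b; rewrite ?normr0 ?normr1.
have s1 := sin_max phi; have c1 := cos_max phi.
rewrite /angular_coef (le_trans (ler_normD _ _))// lerD//; last by do ?[apply M1|apply X1].
rewrite (le_trans (ler_normD _ _))// lerD//; last by do ?[apply M1|apply X1].
rewrite -!mulrA mulrCA normrM.
have H : `|(S k)%:R * ((if odd k then sigma else 1) * (sin phi ^+ k * cos phi))| <= 1.
  by do ?[apply M1|apply X1] => //; case: odd; rewrite ?normr1.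
have [kN|kN] := ltnP k N.
  apply: (le_trans (ler_wpM2l (normr_ge0 _) H)); rewrite mulr1.
  by rewrite (bigD1 (Ordinal kN))//= lerDl sumr_ge0.
have -> : S k = false by rewrite /S; case: odd; lia.
by rewrite mul0r normr0 mulr0 sumr_ge0.
Qed.

Lemma field_coef_periodic k : periodic (field_coef k) tau.
Proof. by move=> phi; rewrite /field_coef sinD2pi cosD2pi. Qed.

Lemma planar_field_polar eps :
  polar_field N field_coef eps (planar_field damping switched eps).
Proof.
move=> phi r r0; rewrite /planar_field /field_of /=; congr (_, _ - _ * _).
by rewrite perturbation_polar sgrM gtr0_sg// mul1r.
Qed.

Lemma field_of_polar eps sigma :
  polar_field N (fun k phi => angular_coef sigma (sin phi) (cos phi) k) eps
    (field_of damping switched eps sigma).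
Proof. by move=> phi r r0; rewrite /field_of /= perturbation_polar. Qed.

Lemma continuous_perturbation (c1 c2 : R -> R) : continuous c1 -> continuous c2 ->
  continuous (fun t => damping.[c1 t] * c2 t +
    Num.sg (c1 t) * switched.[(c1 t)%:P].[c2 t]).
Proof.
move=> cc1 cc2.
have -> : (fun t => damping.[c1 t] * c2 t +
    Num.sg (c1 t) * switched.[(c1 t)%:P].[c2 t]) = fun t => damping.[c1 t] * c2 t +
    \sum_(k < m.+1) (if odd k then (if k == m :> nat then 1 else q k * c2 t) else 0) *
      `|c1 t| ^+ k.
  apply/funext => t; rewrite switched_eval mulr_sumr; congr (_ + _).
  apply: eq_bigr => k _; case: (boolP (odd k)) => ok; last by rewrite !mul0r mulr0.
  by rewrite mulrCA sgX_odd.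
move=> t; apply: cvgD.
  apply: cvgM; last exact: cc2.
  apply: (@continuous_comp _ _ _ c1 (horner damping)); first exact: cc1.
  exact: (is_derive_continuous (is_derive_poly damping)).
move: t; apply: continuous_big => [|k _ t]; first exact: add_continuous.
apply: cvgM.
  case: (odd k); last exact: cvg_cst.
  by case: eqP => _; [exact: cvg_cst|apply: cvgM; [exact: cvg_cst|exact: cc2]].
apply: (@continuous_comp _ _ _ (fun s : R => `|c1 s|) (fun x => x ^+ k)).
  by apply: (@continuous_comp _ _ _ c1 (fun x => `|x|)); [exact: cc1|exact: norm_continuous].
exact: exprn_continuous.
Qed.

(** The degree-adjusting summands contribute sin^n cos^2 with n odd and |sin|^m cos, which change
    sign under a half turn and so average to zero. *)
Lemma mean_field_coef k (a : R) :
  has_mean (fun phi : R => cos phi ^+ 2 * `|sin phi| ^+ k) a ->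
  has_mean (fun phi => cos phi * field_coef k phi) ((S k)%:R * q k * a).
Proof.
move=> ma.
have m1 : odd n -> has_mean (fun phi : R => sin phi ^+ n * cos phi ^+ 2) 0.
  move=> on; apply: has_mean_antiperiodic; first exact: continuous_trig_pow.
  by move=> phi; rewrite sinDpi cosDpi sqrrN exprNn -signr_odd on mulN1r mulNr.
have m2 : has_mean (fun phi : R => `|sin phi| ^+ m * cos phi ^+ 1) 0.
  apply: has_mean_antiperiodic; first exact: continuous_abs_sin_pow.
  by move=> phi; rewrite sinDpi cosDpi normrN !expr1 mulrN.
have m1' : has_mean (fun phi : R =>
    (odd n && (k == n))%:R * (sin phi ^+ n * cos phi ^+ 2)) 0.
  case: (boolP (odd n)) => [/m1 on|_].
    by have := has_meanZ (true && (k == n))%:R on; rewrite mulr0.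
  rewrite (_ : (fun _ => _) = fun=> 0); first exact: has_mean0.
  by apply/funext => phi; rewrite mul0r.
have m2' := has_meanZ (odd m && (k == m.-1))%:R m2.
have := has_meanD (has_meanD (has_meanZ ((S k)%:R * q k) ma) m1') m2'.
rewrite mulr0 !addr0 (_ : (fun _ => _) = fun phi => cos phi * field_coef k phi)//.
by apply/funext => phi; rewrite field_coefE expr1; ring.
Qed.

End Example.

Theorem theorem1 (R : realType) (n m : nat) (hn : (1 <= n)%N) (hm : (2 <= m)%N) :
  (((Hmn m n)%:R : R)%:E <= max_bifurcating R m n)%E /\
  (exists (f : {poly R}) (g : {poly {poly R}}),
     [/\ poly_degree f n, total_degree g m &
         exactly_bifurcating f g (Hmn m n)]).
Proof.
suff [f [g [df dg [al am]]]] : exists (f : {poly R}) (g : {poly {poly R}}),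
    [/\ poly_degree f n, total_degree g m & exactly_bifurcating f g (Hmn m n)].
  split; last by exists f, g.
  apply: ereal_sup_ubound; exists (Hmn m n) => //=.
  by exists f, g.
have [c [cS roots simple all_roots]] :=
  sparse_poly_prescribed_roots R (sum_monomial_exponents n hm).
have /choice[a aP] : forall k, exists a : R, 0 < a /\
    has_mean (fun phi : R => cos phi ^+ 2 * `|sin phi| ^+ k) a.
  by move=> k; have [a] := positive_mean R k; exists a.
(* Dividing by the averages [a k] makes the averaged polynomial exactly the one with coefficients
   [c]. *)
pose q k := c k / a k.
have q0 k : (k < (n + m).+1)%N -> monomial_exponents n m k -> q k != 0.
  by move=> kN Sk; rewrite mulf_neq0 ?invr_eq0 ?cS// gt_eqF// (aP k).1.
pose gam k := (monomial_exponents n m k)%:R * q k * a k.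
have polyE : \poly_(k < (n + m).+1) gam k = \poly_(k < (n + m).+1) c k.
  apply/polyP => k; rewrite !coef_poly; case: ifP => // kN.
  rewrite /gam /q -mulrA divfK ?gt_eqF ?(aP k).1//.
  by have := cS k kN; case: monomial_exponents; rewrite ?mul1r// mul0r => /negbFE/eqP ->.
have mean_h k : has_mean (fun phi => cos phi * field_coef n m q k phi) (gam k).
  exact: mean_field_coef (aP k).2.
have [M HM] := angular_coef_bounded n q hm.
have bh : exists M, forall k phi, `|field_coef n m q k phi| <= M.
  exists M => k phi; apply: HM.
  by rewrite normr_sg; case: eqP => _; rewrite ?lexx ?ler01.
have bhs sigma : `|sigma| = 1 -> exists M, forall k phi,
    `|angular_coef n m q sigma (sin phi) (cos phi) k| <= M.
  by move=> s1; exists M => k phi; apply: HM; rewrite s1.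
exists (damping n q), (switched m q); split.
- apply: size_damping => en; apply: q0; first lia.
  by rewrite /monomial_exponents (negbTE en).
- apply: total_degree_switched => // em; apply: q0; first lia.
  by rewrite /monomial_exponents ifT; lia.
- have field_h eps := planar_field_polar n q hm eps.
  have field_hs eps sigma (_ : `|sigma| = 1) := field_of_polar n q hm eps sigma.
  have rs_inj : injective (fun i : 'I_(Hmn m n) => i.+1%:R : R).
    by move=> i j /eqP; rewrite eqr_nat eqSS => /eqP/val_inj.
  rewrite -polyE in roots simple all_roots; split.
  + apply: (at_least_roots (@switched0 R m q) bh (@continuous_field_coef R n m q)
      (@field_coef_periodic R n m q) mean_h bhs _ field_h field_hs _ rs_inj _ roots simple) => //.
    * by move=> sigma k _; exact: continuous_angular_coef.
    * by move=> c1 c2; exact: continuous_perturbation.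
  + apply: (at_most_roots (@switched0 R m q) bh mean_h field_h _ _ roots simple) => //.
    * by move=> c1 c2; exact: continuous_perturbation.
Qed.
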